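(* Let $\sigma:\mathbb{R}\to\mathbb{R}$ be a twice differentiable function such that $\sigma$, $\sigma'$ and $\sigma''$ are Lipschitz continuous, and let $Z$ be a nonnegative random variable on $(\Omega,\mathcal{F},\mathbf{P})$ (possibly depending on the whole Brownian path $(B_s)_{s\in[0,1]}$). Then there is a pair of processes $(X_t(Z),L_t^Z,\ t\in[0,1])$ that solves the anticipating reflected stochastic differential equation $$X_t(Z)=Z+\int_0^t\sigma(X_s(Z))\circ dB_s+L_t^Z,\qquad \forall\, t\in[0,1],$$ where the stochastic integral is the anticipating Stratonovich integral, and which satisfies: (i) $X_0(Z)=Z$ and $X_t(Z)\ge 0$ for $t\in[0,1]$; (ii) $X_t(Z)$ and $L_t^Z$ are continuous in $t$; (iii) $L_t^Z$ is non-decreasing in $t$ with $L_0^Z=0$ and $$\int_0^t\chi_{\{X_s(Z)=0\}}\,dL_s^Z=L_t^Z,\qquad t\in[0,1].$$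
   Context: $B$ is a standard real-valued Brownian motion on a complete filtered probability space $(\Omega,\mathcal{F},\{\mathcal{F}_t\}_{t\in[0,1]},\mathbf{P})$ satisfying the usual conditions. $\chi_A$ denotes the indicator of $A$. The processes $X_t(Z),L_t^Z$ are not required to be adapted. Anticipating Stratonovich integral: for $t\in[0,1]$ and a partition $\pi=\{0=t_0<t_1<\dots<t_n=t\}$ of $[0,t]$ put $\|\pi\|=\sup_{0\le k\le n-1}(t_{k+1}-t_k)$. For a stochastic process $f=\{f_s,\ s\in[0,1]\}$ with $\int_0^t|f_s|\,ds<\infty$ a.s., put $$S_\pi(f,t)=\sum_{k=0}^{n-1}\frac{1}{t_{k+1}-t_k}\Big(\int_{t_k}^{t_{k+1}}f_s\,ds\Big)(B_{t_{k+1}}-B_{t_k}).$$ The process $f$ is Stratonovich integrable on $[0,t]$ if $S_\pi(f,t)$ converges in probability as $\|\pi\|\to0$; the limit is denoted $\int_0^t f_s\circ dB_s$. The pair solves the equation if, for every $t\in[0,1]$, the process $\sigma(X_\cdot(Z))$ is Stratonovich integrable on $[0,t]$ in this sense and the equation holds almost surely. *)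

(* Defs.v *)
From HB Require Import structures.
From mathcomp Require Import all_boot all_order all_algebra.
From mathcomp Require Import all_classical all_reals all_analysis.

Set Implicit Arguments.
Unset Strict Implicit.
Unset Printing Implicit Defensive.

Import Order.TTheory GRing.Theory Num.Theory.
Import numFieldNormedType.Exports.

Local Open Scope classical_set_scope.
Local Open Scope ring_scope.

(* Processes and filtrations have time set [0, 1]; they are indexed by all of
   R, and their values outside [0, 1] play no role. *)

Record usual_filtration (R : realType) (d : measure_display)
    (T : measurableType d) (P : probability T R) (F : R -> set (set T)) : Prop := {
  filtration_sigma_algebra :
    forall t : R, 0 <= t <= 1 -> sigma_algebra [set: T] (F t) ;
  filtration_measurable :
    forall t : R, 0 <= t <= 1 -> F t `<=` measurable ;
  filtration_nondecreasing :
    forall s t : R, 0 <= s -> s <= t -> t <= 1 -> F s `<=` F t ;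
  filtration_space_complete : measure_is_complete P ;
  filtration_negligible : P.-negligible `<=` F 0 ;
  filtration_right_continuous :
    forall t : R, 0 <= t < 1 -> F t = \bigcap_(s in `]t, 1]) F s }.

(* The second argument of normal_prob is the standard deviation. *)
Record brownian_motion (R : realType) (d : measure_display)
    (T : measurableType d) (P : probability T R) (F : R -> set (set T))
    (B : R -> {RV P >-> R}) : Prop := {
  brownian_adapted :
    forall t : R, 0 <= t <= 1 ->
    forall U : set R, measurable U -> F t (B t @^-1` U) ;
  brownian_start : {ae P, forall w, B 0 w = 0} ;
  brownian_independent_increments :
    forall s t : R, 0 <= s -> s < t -> t <= 1 ->
    forall (A : set T) (U : set R), F s A -> measurable U ->
      P (A `&` (fun w => B t w - B s w) @^-1` U)
      = (P A * P ((fun w => (B t w - B s w)%R) @^-1` U))%E ;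
  brownian_gaussian_increments :
    forall s t : R, 0 <= s -> s < t -> t <= 1 ->
    forall U : set R, measurable U ->
      P ((fun w => B t w - B s w) @^-1` U) = normal_prob 0 (Num.sqrt (t - s)) U ;
  brownian_continuous :
    {ae P, forall w, {within `[0, 1], continuous (fun t => B t w)}} }.

(* As in the library's itv_partition, the partition 0 = t_0 < ... < t_n = t is
   encoded by the sequence p = [:: t_1; ...; t_n] (empty when t = 0). *)
Definition pt (R : realType) (p : seq R) (k : nat) : R := nth 0 (0 :: p) k.

Definition mesh (R : realType) (p : seq R) : R :=
  \big[Num.max/0]_(k < size p) (pt p k.+1 - pt p k).

Definition strat_sum (R : realType) (T : Type) (B f : R -> T -> R)
    (p : seq R) (w : T) : R :=
  \sum_(k < size p)
    (pt p k.+1 - pt p k)^-1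
    * (\int[lebesgue_measure]_(s in `[pt p k, pt p k.+1]) f s w)%R
    * (B (pt p k.+1) w - B (pt p k) w).

(* Joint measurability of f is what makes the inner integrals, hence the sums
   S_pi(f, t), random variables. *)
Record is_strat_integral (R : realType) (d : measure_display)
    (T : measurableType d) (P : probability T R) (B : R -> {RV P >-> R})
    (f : R -> T -> R) (t : R) (I : {RV P >-> R}) : Prop := {
  strat_measurable :
    measurable_fun (`[0, t] `*` [set: T] : set (measurableTypeR R * T))
      (fun z => f z.1 z.2) ;
  strat_integrable :
    {ae P, forall w, (\int[lebesgue_measure]_(s in `[0%R, t]) `|f s w|%:E < +oo)%E} ;
  strat_cvg_in_probability :
    forall e h : R, 0 < e -> 0 < h ->
    exists2 delta : R, 0 < delta &
      forall p : seq R, itv_partition 0 t p -> mesh p < delta ->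
        (P [set w | (e < `|strat_sum (fun s => B s : T -> R) f p w - I w|)%R] <= h%:E)%E }.

(* v = \int_0^t h_s dg_s in the Lebesgue-Stieltjes sense; G is the function g,
   given on [0, 1], continued by the constants g 0 and g 1. *)
Definition is_stieltjes_integral (R : realType) (h g : R -> R) (t v : R) : Prop :=
  exists2 G : cumulative R R,
    forall s, G s = g (Num.max 0 (Num.min s 1)) &
    (\int[lebesgue_stieltjes_measure G]_(s in `[0%R, t]) (h s)%:E = v%:E)%E.

Definition twice_differentiable (R : realType) (sigma : R -> R) : Prop :=
  forall x : R, derivable sigma x 1 /\ derivable (derive1 sigma) x 1.

Definition solves_reflected_sde (R : realType) (d : measure_display)
    (T : measurableType d) (P : probability T R) (B : R -> {RV P >-> R})
    (sigma : R -> R) (Z : {RV P >-> R}) (X L : R -> {RV P >-> R}) : Prop :=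
  forall t : R, 0 <= t <= 1 ->
  exists2 I : {RV P >-> R},
    is_strat_integral B (fun s w => sigma (X s w)) t I &
    {ae P, forall w, X t w = Z w + I w + L t w}.

(* Main.v *)
Require Import Defs.
From HB Require Import structures.
From mathcomp Require Import all_boot all_order all_algebra.
From mathcomp Require Import all_classical all_reals all_analysis.
From mathcomp Require Import measurable_realfun zify ring lra.

Set Implicit Arguments.
Unset Strict Implicit.
Unset Printing Implicit Defensive.

Import Order.TTheory GRing.Theory Num.Theory.
Import numFieldNormedType.Exports.

Local Open Scope classical_set_scope.
Local Open Scope ring_scope.

(** The Stratonovich integral obeys the ordinary chain rule, so the equation
  [dX = s(X) o dB] is solved path by path, as Doss and Sussmann do, by
  [X = phi z B], where [phi z] is the solution of [x' = s x] that starts at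
  [z]. The initial value is only a parameter of each path, so it may depend on
  the whole of [B].

  Reflection at [0] shifts the time of the flow. Replace [sigma] and [B] by
  [s = sg * sigma] and [beta = sg * B], with the sign [sg] for which
  [0 <= s 0]; this leaves the integral unchanged. Let [a] be the time that the
  flow needs from [0] to [Z], so that [phi Z (- a) = 0]. The path
  [X = phi Z (beta + r)] remains nonnegative when [- a <= beta + r], and the
  least nondecreasing [r] with this property is Skorokhod's
  [r t = max 0 (sup_[0, t] (- beta) - a)]. When [Z] is out of reach of [0],
  the flow stays nonnegative and [r = 0]. As [r] grows only where [X = 0], the
  chain rule [dX = s(X) o dbeta + s(X) dr] becomes
  [dX = sigma(X) o dB + s 0 dr], and [L = s 0 * r]. These facts are
  [ex_reflection_time], [push_only_at_boundary] and
  [stieltjes_supported_on_zeros]; the times at which [X] is positive are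
  covered by countably many intervals on which [L] is constant.

  The chain rule has to be proved for the averaged sums and an integrand that
  is not adapted. On a cell [[a, c]] of the partition and for a point [u] of
  it, expand [G = phi Z], whose derivative is [g = s o G], from [u] towards both
  ends. The first order terms add up to [g (beta_c - beta_a)] and the second
  order terms have opposite signs: what remains is half of the derivative of
  [g] times [(beta_c - beta_u)^2 - (beta_u - beta_a)^2]
  ([pointwise_expansion]). Averaged over [u], the two squares have the same
  expectation. The random weight, which depends on the future, is frozen on
  finitely many blocks of fixed length ([strat_sum_error]); it is then merely
  bounded on a likely event, and the unweighted sums over a block tend to [0]
  because compensated squares over disjoint intervals are orthogonal
  ([sum_comp_sq_second_moment]). The cost of freezing is controlled by the sum
  of the squared increments, whose expectation is bounded, and by the modulus
  of continuity of the paths. [likely_strat_sum] collects these bounds. *)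

(** * Calculus on the real line *)

Section calculus.
Context {R : realType}.
Implicit Types (f g : R -> R) (x y : R).

Lemma is_derive1D f g x df dg : is_derive x 1 f df -> is_derive x 1 g dg ->
  is_derive x 1 (fun y => f y + g y) (df + dg).
Proof. exact: is_deriveD. Qed.

Lemma is_derive1B f g x df dg : is_derive x 1 f df -> is_derive x 1 g dg ->
  is_derive x 1 (fun y => f y - g y) (df - dg).
Proof. exact: is_deriveB. Qed.

Lemma is_derive1M f g x df dg : is_derive x 1 f df -> is_derive x 1 g dg ->
  is_derive x 1 (fun y => f y * g y) (df * g x + f x * dg).
Proof.
move=> Hf Hg; have := is_deriveM Hf Hg; rewrite /GRing.scale/= => H.
by apply: (is_derive_eq H); ring.
Qed.

Lemma is_derive1Zl f x df c : is_derive x 1 f df ->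
  is_derive x 1 (fun y => c * f y) (c * df).
Proof. exact: is_deriveZ. Qed.

Lemma is_derive1_expR c x :
  is_derive x 1 (fun y => expR (c * y)) (c * expR (c * x)).
Proof.
have h : is_derive x 1 (fun y : R => c * y) c.
  by have := is_derive1Zl c (is_derive_id x 1); rewrite mulr1.
have := @is_derive1_comp _ expR _ x _ _ (is_derive_expR (c * x)) h.
by rewrite mulrC.
Qed.

Lemma is_derive1_opp f x df : is_derive (- x) 1 f df ->
  is_derive x 1 (fun y => f (- y)) (- df).
Proof.
move=> h.
have := @is_derive1_comp _ f -%R x _ _ h (is_deriveNid x 1).
by rewrite mulrN1.
Qed.

Lemma is_derive1_shift f x c df : is_derive (x + c) 1 f df ->
  is_derive x 1 (fun y => f (y + c)) df.
Proof.
move=> h.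
have h2 : is_derive x 1 (fun y => y + c) 1.
  by have := is_derive1D (is_derive_id x 1) (is_derive_cst c x 1); rewrite addr0.
by have := @is_derive1_comp _ f _ x _ _ h h2; rewrite mulr1.
Qed.

Lemma continuous_const (c : R) : continuous (fun _ : R => c).
Proof. exact: cst_continuous. Qed.

Lemma continuous_add f g : continuous f -> continuous g ->
  continuous (fun x => f x + g x : R).
Proof. by move=> cf cg x; apply: cvgD; [exact: cf|exact: cg]. Qed.

Lemma continuous_sub f g : continuous f -> continuous g ->
  continuous (fun x => f x - g x : R).
Proof. by move=> cf cg x; apply: cvgB; [exact: cf|exact: cg]. Qed.

Lemma continuous_mul f g : continuous f -> continuous g ->
  continuous (fun x => f x * g x : R).
Proof. by move=> cf cg x; apply: cvgM; [exact: cf|exact: cg]. Qed.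

Lemma continuous_sqr f : continuous f -> continuous (fun x => f x ^+ 2 : R).
Proof. by move=> cf; under [X in continuous X]eq_fun do rewrite expr2; exact: continuous_mul. Qed.

Lemma continuous_norm f : continuous f -> continuous (fun x => `|f x| : R).
Proof. by move=> cf x; apply: cvg_norm; exact: cf. Qed.

Lemma continuous_compose f g : continuous f -> continuous g ->
  continuous (fun x => f (g x)).
Proof. by move=> cf cg x; apply: (continuous_comp (cg x)); exact: cf. Qed.

Lemma is_derive_continuous f df : (forall x, is_derive x 1 f (df x)) ->
  continuous f.
Proof.
by move=> h x; apply/differentiable_continuous/derivable1_diffP; have [] := h x.
Qed.

Lemma mean_value f df a b : (forall x, is_derive x 1 f (df x)) -> a <= b ->
  exists2 c, a <= c <= b & f b - f a = df c * (b - a).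
Proof.
move=> h ab; have := @MVT_segment _ f df a b ab (fun x _ => h x).
have /continuous_subspaceT fc := is_derive_continuous h.
by move=> /(_ (fc _))[c]; rewrite in_itv/= => cab; exists c.
Qed.

Lemma nondecreasing_of_derive f df a b :
  (forall x, is_derive x 1 f (df x)) -> a <= b ->
  (forall x, a < x < b -> 0 <= df x) -> f a <= f b.
Proof.
move=> h; rewrite le_eqVlt => /predU1P[->//|ab df0].
have := @MVT _ f df a b ab (fun x _ => h x).
have /continuous_subspaceT fc := is_derive_continuous h.
move=> /(_ (fc _))[c]; rewrite in_itv/= => cab fE.
by rewrite -subr_ge0 fE mulr_ge0 ?df0// subr_ge0 ltW.
Qed.

(** Gronwall's inequality for two-sided time: the square of [f] times
  [exp (-2 k x)] is nonincreasing on the right of the origin. *)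
Lemma gronwall f df k : 0 <= k -> (forall x, is_derive x 1 f (df x)) ->
  (forall x, `|df x| <= k * `|f x|) ->
  forall x, `|f x| <= `|f 0| * expR (k * `|x|).
Proof.
move=> k0.
wlog suff : f df / (forall x, is_derive x 1 f (df x)) ->
    (forall x, `|df x| <= k * `|f x|) ->
    forall x, 0 <= x -> `|f x| <= `|f 0| * expR (k * x).
  move=> H fd dfk x; have [x0|x0] := leP 0 x.
    by rewrite (ger0_norm x0) (H f df).
  rewrite (ltr0_norm x0) -{1}(opprK x).
  have := H (fun y => f (- y)) (fun y => - df (- y)) _ _ (- x).
  rewrite oppr0; apply => [y|y|]; last by rewrite oppr_ge0 ltW.
    exact: is_derive1_opp.
  by rewrite normrN.
move=> fd dfk x x0.
pose F y := (-1) * (f y * f y * expR (- (2 * k) * y)).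
have Fd y : is_derive y 1 F
  ((-1) * ((df y * f y + f y * df y) * expR (- (2 * k) * y)
   + f y * f y * (- (2 * k) * expR (- (2 * k) * y)))).
  apply: is_derive1Zl; apply: is_derive1M; last exact: is_derive1_expR.
  exact: is_derive1M.
have : F 0 <= F x.
  apply: (nondecreasing_of_derive Fd x0) => y _.
  have -> : -1 * ((df y * f y + f y * df y) * expR (- (2 * k) * y) +
     f y * f y * (- (2 * k) * expR (- (2 * k) * y))) =
    2 * (k * (f y * f y) - df y * f y) * expR (- (2 * k) * y) by ring.
  rewrite mulr_ge0 ?expR_ge0// mulr_ge0// subr_ge0.
  rewrite (le_trans (ler_norm _))// normrM (le_trans (ler_wpM2r _ (dfk y)))//.
  by rewrite -mulrA -normrM ger0_norm// -expr2 sqr_ge0.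
rewrite /F mulr0 expR0 mulr1 2!mulN1r lerN2.
have e0 := expR_gt0 (2 * k * x).
rewrite mulNr expRN -[X in X <= _]mulr1 -!expr2 mulr1 ler_pdivrMr//.
rewrite -!(real_normK (num_real (f _))).
have -> : expR (2 * k * x) = expR (k * x) ^+ 2 by rewrite -expRM_natl; congr expR; ring.
rewrite -exprMn ler_pXn2r// nnegrE ?mulr_ge0 ?expR_ge0//.
Qed.

(** The weight [expR (k |x|)] is its own primitive up to the factor [k]; this
  makes Picard's operator a contraction for the weighted supremum norm. *)
Lemma expR_dominated f df k c : 0 < k -> (forall x, is_derive x 1 f (df x)) ->
  f 0 = 0 -> (forall x, `|df x| <= k * (c * expR (k * `|x|))) ->
  forall x, `|f x| <= c * expR (k * `|x|).
Proof.
move=> k0.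
wlog suff : f df / (forall x, is_derive x 1 f (df x)) -> f 0 = 0 ->
    (forall x, `|df x| <= k * (c * expR (k * `|x|))) ->
    forall x, 0 <= x -> f x <= c * expR (k * x).
  move=> H fd f0 dfk x.
  have c0 : 0 <= c.
    have := le_trans (normr_ge0 _) (dfk 0).
    by rewrite normr0 mulr0 expR0 mulr1 pmulr_rge0.
  have HN := H (fun y => -1 * f y) (fun y => -1 * df y).
  have {HN} := HN (fun y => is_derive1Zl _ (fd y)).
  rewrite f0 mulr0 => /(_ erefl) HN.
  have {}HN : forall x, 0 <= x -> - f x <= c * expR (k * x).
    by move=> y y0; rewrite -mulN1r; apply: HN => // z; rewrite normrM normrN1 mul1r.
  have HP := H _ _ fd f0 dfk.
  have [x0|x0] := leP 0 x.
    by rewrite (ger0_norm x0) ler_norml lerNl HN// HP.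
  have xx0 : 0 <= - x by rewrite oppr_ge0 ltW.
  have fNd y : is_derive y 1 (fun y => f (- y)) (- df (- y)) by exact: is_derive1_opp.
  have H1 := H _ _ fNd; rewrite oppr0 in H1.
  have {}H1 := H1 f0; have {}H1 : f x <= c * expR (k * - x).
    by rewrite -{1}(opprK x); apply: H1 => // y; rewrite normrN (le_trans (dfk _))// normrN.
  have H2 := H _ _ (fun y => is_derive1Zl (-1) (fNd y)); rewrite oppr0 f0 mulr0 in H2.
  have {}H2 := H2 erefl; have {}H2 : - f x <= c * expR (k * - x).
    rewrite -{1}(opprK x) -mulN1r; apply: H2 => // y.
    by rewrite normrM normrN1 mul1r normrN (le_trans (dfk _))// normrN.
  by rewrite (ltr0_norm x0) ler_norml lerNl H1 H2.
move=> fd f0 dfk x x0.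
have c0 : 0 <= c.
  have := le_trans (normr_ge0 _) (dfk 0).
  by rewrite normr0 mulr0 expR0 mulr1 pmulr_rge0.
pose F y := c * expR (k * y) - f y.
have Fd y : is_derive y 1 F (c * (k * expR (k * y)) - df y).
  apply: is_derive1B => //; apply: is_derive1Zl; exact: is_derive1_expR.
have : F 0 <= F x.
  apply: (nondecreasing_of_derive Fd x0) => y /andP[y0 _].
  rewrite subr_ge0 (le_trans (ler_norm _))// (le_trans (dfk _))// gtr0_norm//.
  by rewrite mulrCA.
by rewrite /F f0 subr0 => h; rewrite -subr_ge0 (le_trans _ h)// mulr_ge0 ?expR_ge0.
Qed.

(** Two mean values reduce the remainder to the oscillation of [g1]. *)
Lemma second_order_expansion (G g g1 : R -> R) (c eta u v : R) :
  (forall x : R, is_derive x 1 G (g x)) ->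
  (forall x : R, is_derive x 1 g (g1 x)) ->
  (forall x, Num.min u v <= x <= Num.max u v -> `|g1 x - c| <= eta) ->
  `|G v - G u - g u * (v - u) - 2^-1 * c * (v - u) ^+ 2| <= eta * (v - u) ^+ 2.
Proof.
move=> Gd gd g1c.
have eta0 : 0 <= eta.
  by apply: le_trans (g1c u _) => //; rewrite ge_min le_max !lexx.
have mv (f df : R -> R) (x y : R) : (forall z : R, is_derive z 1 f (df z)) ->
    exists2 z, Num.min x y <= z <= Num.max x y & f y - f x = df z * (y - x).
  move=> fd; have [xy|/ltW xy] := leP x y; first exact: mean_value.
  have [z zxy fz] := mean_value fd xy; exists z => //.
  by rewrite -opprB fz -mulrN opprB.
pose D (y : R) := G y - (g u * (y - u) + 2^-1 * c * ((y - u) * (y - u))).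
have subd (y : R) : is_derive y 1 (fun y : R => y - u) (1 - 0).
  exact: is_derive1B.
have Dd (y : R) : is_derive y 1 D (g y - (g u * (1 - 0) +
    2^-1 * c * ((1 - 0) * (y - u) + (y - u) * (1 - 0)))).
  apply: is_derive1B => //.
  exact: (is_derive1D (is_derive1Zl _ (subd y))
    (is_derive1Zl _ (is_derive1M (subd y) (subd y)))).
have [z zuv Dz] := mv _ _ u v Dd.
have [y yuz gy] := mv _ _ u z gd.
have -> : G v - G u - g u * (v - u) - 2^-1 * c * (v - u) ^+ 2 = D v - D u.
  by rewrite /D; ring.
have -> : D v - D u = (g1 y - c) * (z - u) * (v - u).
  rewrite Dz.
  have -> : g z = g u + g1 y * (z - u) by rewrite -gy; ring.
  by field.
have yuv : Num.min u v <= y <= Num.max u v.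
  move: zuv yuz; case: (leP u v) => uv; case: (leP u z) => uz; lra.
have zu : `|z - u| <= `|v - u|.
  move: zuv; case: (leP u v) => uv zuv.
    by rewrite !ger0_norm ?subr_ge0 ?lerD2r; lra.
  by rewrite !ler0_norm ?subr_le0 ?opprB; lra.
have -> : (v - u) ^+ 2 = `|v - u| * `|v - u|.
  by rewrite -normrM -expr2 ger0_norm// sqr_ge0.
rewrite !normrM -mulrA.
by apply: ler_pM => //; [exact: g1c|apply: ler_wpM2r].
Qed.

Lemma lipschitz_bound f : lipschitz f ->
  exists2 k, 0 < k & forall x y, `|f x - f y| <= k * `|x - y|.
Proof.
move=> fl; have := fl; rewrite /lipschitz_on => -[M [_ HM]].
pose k := Num.max 1 (M + 1); exists k; first by rewrite lt_max ltr01.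
move=> x y; have := HM k; rewrite lt_max ltrDl ltr01 orbT => /(_ isT).
by move=> /(_ (x, y)) /=; apply.
Qed.

Lemma lipschitz_continuous f k :
  (forall x y, `|f x - f y| <= k * `|x - y|) -> continuous f.
Proof.
move=> fk.
have fk' x y : `|f x - f y| <= (`|k| + 1) * `|x - y|.
  by rewrite (le_trans (fk _ _))// ler_wpM2r// (le_trans (ler_norm _))// lerDl.
move=> x; apply/cvgrPdist_le => e e0; near=> y.
rewrite (le_trans (fk' _ _))// -ler_pdivlMl ?ltr_wpDl//.
near: y; apply: (@cvgr_dist_le _ _ R _ _ id x) => //.
by rewrite mulr_gt0// invr_gt0 ltr_wpDl.
Unshelve. all: by end_near. Qed.

Lemma continuous_near_point f x e : continuous f -> 0 < e ->
  exists2 d, 0 < d & forall y, `|y - x| < d -> `|f y - f x| < e.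
Proof.
move=> cf e0; have /cvgrPdist_lt/(_ e e0)/nbhs_ballP[d /= d0 hd] := cf x.
by exists d => // y yx; rewrite distrC; apply: hd; rewrite /ball/= distrC.
Qed.

End calculus.

(** * The flow of a Lipschitz equation *)

Section flow.
Context {R : realType}.
Implicit Types (f g : R -> R) (x y : R).
Local Notation mu := (@lebesgue_measure R).

Lemma continuous_integrable_segment g (a b : R) : continuous g ->
  mu.-integrable `[a, b] (EFin \o g).
Proof.
move=> cg; apply: continuous_compact_integrable; first exact: segment_compact.
exact: continuous_subspaceT.
Qed.

Lemma ex_primitive g : continuous g ->
  exists2 F : R -> R, F 0 = 0 & forall x, is_derive x 1 F (g x).
Proof.
move=> cg.
pose I (a x : R) : R := (\int[mu]_(t in `[a, x]) g t)%R.
have IB a b x : a <= b -> b <= x -> I a x - I a b = I b x.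
  move=> ab bx; have ig := @continuous_integrable_segment g _ _ cg.
  rewrite /I (@Rintegral_itvB _ g (BLeft a) (BRight x) b)// Rintegral_itv_obnd_cbnd//.
  by apply: integrableS (ig b x) => //; apply: subset_itvr; rewrite bnd_simp.
pose F x := if 0 <= x then I 0 x else - I x 0.
have FE (a x : R) : a <= 0 -> a <= x -> I a x - I a 0 = F x.
  move=> a0 ax; rewrite /F; case: (leP 0 x) => [x0|/ltW x0].
    by rewrite (IB a 0 x).
  by rewrite -(IB a x 0)// opprB.
exists F; first by rewrite /F lexx /I set_itv1 Rintegral_set1.
move=> x.
(* near [x] the integral is taken from a base point to the left of [x] and 0 *)
pose a := - `|x| - 1.
have ax : a < x by rewrite /a; have := ler_norm (- x); rewrite normrN; lra.
have a0 : a <= 0 by rewrite /a; have := normr_ge0 x; lra.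
have xx1 : x < x + 1 by rewrite ltrDl.
have [Id Ie] := @continuous_FTC1_closed R g a x (x + 1) xx1
  (continuous_integrable_segment _ _ cg) ax (cg x).
apply: (@near_eq_is_derive _ _ _ (fun y => I a y - I a 0)).
  near=> y; apply: FE => //; apply: ltW; near: y; exact: lt_nbhsr.
have Ide : 'D_1 (I a) x = g x by rewrite -derive1E.
have Ida : is_derive x 1 (I a) (g x) := DeriveDef Id Ide.
by have := is_derive1B Ida (is_derive_cst (I a 0) x 1); rewrite subr0.
Unshelve. all: by end_near. Qed.

(** A sequence with geometrically decreasing steps is trapped between the
  nondecreasing sequence [u n - 2 c / 2 ^ n] and the nonincreasing sequence
  [u n + 2 c / 2 ^ n]. *)
Lemma geometric_steps_limit (u : nat -> R) (c : R) :
  (forall n, `|u n.+1 - u n| <= c * 2^-1 ^+ n) ->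
  exists l, forall n, `|u n - l| <= 2 * c * 2^-1 ^+ n.
Proof.
move=> uc.
pose e n := 2 * c * 2^-1 ^+ n.
have eS n : e n.+1 = e n - c * 2^-1 ^+ n.
  by rewrite /e exprS; field.
have e0 n : 0 <= e n.
  rewrite /e; have := le_trans (normr_ge0 _) (uc n); lra.
have inc n k : u n - e n <= u (n + k)%N - e (n + k)%N.
  elim: k => [|k IH]; first by rewrite addn0.
  rewrite (le_trans IH)// addnS eS; have := uc (n + k)%N.
  by rewrite ler_norml; lra.
have dec n k : u (n + k)%N + e (n + k)%N <= u n + e n.
  elim: k => [|k IH]; first by rewrite addn0.
  apply: le_trans IH; rewrite addnS eS; have := uc (n + k)%N.
  by rewrite ler_norml; lra.
have sep n m : u n - e n <= u m + e m.
  have [nm|/ltnW mn] := leqP n m.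
    have := inc n (m - n)%N; rewrite subnKC// => /le_trans; apply.
    by have := e0 m; lra.
  have := dec m (n - m)%N; rewrite subnKC// => /(le_trans _); apply.
  by have := e0 n; lra.
pose S := [set u n - e n | n in setT].
exists (sup S) => n; rewrite ler_norml.
have ubS m : ubound S (u m + e m) by move=> _ [k _ <-].
have Sn : S (u n - e n) by exists n.
have h1 : u n - e n <= sup S by apply: ub_le_sup => //; exists (u 0%N + e 0%N).
have h2 : sup S <= u n + e n by apply: ge_sup; [exists (u n - e n)|exact: ubS].
by rewrite -/(e n); lra.
Qed.

Section picard.
Variables (s : R -> R) (k : R).
Hypotheses (k0 : 0 < k) (sk : forall x y, `|s x - s y| <= k * `|x - y|).

(** Picard iteration started at the constant [z]; the weight [expR (2 k |x|)]
  turns the Lipschitz bound into the contraction factor [1/2]. *)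
Lemma ex_solution (z : R) :
  exists2 f : R -> R, f 0 = z & forall x, is_derive x 1 f (s (f x)).
Proof.
have cs : continuous s := lipschitz_continuous sk.
have /choice[prim primP] : forall g : R -> R, exists F : R -> R,
    continuous g -> F 0 = 0 /\ forall x, is_derive x 1 F (g x).
  move=> g; have [cg|ncg] := pselect (continuous g); last by exists g.
  by have [F F0 Fd] := ex_primitive cg; exists F.
pose it n := iter n (fun f x => z + prim (s \o f) x) (cst z).
have itc n : continuous (it n).
  elim: n => [|n IH]; first exact: cst_continuous.
  have [|_ pd] := primP (s \o it n).
    by move=> x; apply: continuous_comp; [exact: IH|exact: cs].
  by move=> x; apply: cvgD; [exact: cvg_cst|exact: (is_derive_continuous pd)].
have sc n : continuous (s \o it n).
  by move=> x; apply: continuous_comp; [exact: itc|exact: cs].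
have itd n x : is_derive x 1 (it n.+1) (s (it n x)).
  have [_ pd] := primP _ (sc n).
  by rewrite -[s _]add0r; apply: is_derive1D => //; exact: is_derive_cst.
have it0 n : it n 0 = z.
  by case: n => // n; rewrite /= (primP _ (sc n)).1 addr0.
pose c := `|s z| / (2 * k).
have k2 : 0 < 2 * k by rewrite mulr_gt0.
have c0 : 0 <= c by rewrite divr_ge0// ltW.
have step n x : `|it n.+1 x - it n x| <= c * 2^-1 ^+ n * expR (2 * k * `|x|).
  elim: n x => [|n IH].
    rewrite expr0 mulr1; apply: (@expR_dominated R _ (fun x => s z - 0)) => //.
    + by rewrite !it0 subrr.
    move=> x; rewrite subr0 mulrA; have -> : 2 * k * c = `|s z|.
      by rewrite /c; field; rewrite gt_eqF.
    by apply: ler_peMr => //; rewrite -[leLHS]expR0 ler_expR mulr_ge0// ltW.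
  apply: (@expR_dominated R _ (fun x => s (it n.+1 x) - s (it n x))) => //.
  + by rewrite !it0 subrr.
  move=> x; rewrite (le_trans (sk _ _))//.
  rewrite (le_trans (ler_wpM2l (ltW k0) (IH x)))// exprS le_eqVlt.
  by apply/orP; left; apply/eqP; field.
have /choice[f fP] : forall x, exists l, forall n,
    `|it n x - l| <= 2 * (c * expR (2 * k * `|x|)) * 2^-1 ^+ n.
  move=> x; apply: geometric_steps_limit => n.
  by rewrite (le_trans (step n x))// mulrAC.
have small (a e : R) : 0 < e -> exists n, a * 2^-1 ^+ n <= e.
  move=> e0; have : (fun n => a * 2^-1 ^+ n) @ \oo --> a * 0.
    apply: cvgM; first exact: cvg_cst.
    by apply: cvg_expr; rewrite ger0_norm; lra.
  rewrite mulr0 => /cvgrPdist_le/(_ _ e0)[n _ /(_ n (leqnn _))].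
  by rewrite sub0r normrN => /(le_trans (ler_norm _)); exists n.
have cf : continuous f.
  move=> x; apply/cvgrPdist_le => e e0.
  have [n hn] := small (2 * (c * expR (2 * k * (`|x| + 1)))) (e / 3) ltac:(by rewrite divr_gt0).
  have near_bound y : `|y| <= `|x| + 1 -> `|it n y - f y| <= e / 3.
    move=> yx; rewrite (le_trans (fP y n))// (le_trans _ hn)//.
    rewrite ler_wpM2r ?exprn_ge0// ler_wpM2l// ler_wpM2l// ler_expR.
    by rewrite ler_wpM2l// ltW.
  near=> y.
  have yx : `|x - y| <= 1.
    by near: y; apply: (@cvgr_dist_le _ _ R _ _ id x).
  have hy := near_bound y; have hx := near_bound x.
  have hi : `|it n x - it n y| <= e / 3.
    near: y; apply: (@cvgr_dist_le _ _ R _ _ (it n) (it n x)); first exact: itc.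
    exact: divr_gt0.
  have {}hx : `|it n x - f x| <= e / 3 by apply: hx; lra.
  have {}hy : `|it n y - f y| <= e / 3.
    by apply: hy; have := ler_normB x (x - y); rewrite subKr; lra.
  move: hx hy hi; rewrite !ler_norml; lra.
have csf : continuous (s \o f).
  by move=> x; apply: continuous_comp; [exact: cf|exact: cs].
have [p0 pd] := primP _ csf.
have fE x : z + prim (s \o f) x = f x.
  apply/eqP; rewrite -subr_eq0 -normr_eq0 eq_le normr_ge0 andbT.
  apply/ler_addgt0Pl => e e0; rewrite addr0.
  have [n hn] := small (2 * (c * expR (2 * k * `|x|))) e e0.
  rewrite (le_trans _ hn)//.
  have pit : `|prim (s \o f) x - (it n.+1 x - z)| <=
      c * 2^-1 ^+ n * expR (2 * k * `|x|).
    apply: (@expR_dominated R (fun x => prim (s \o f) x - (it n.+1 x - z))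
        (fun x => s (f x) - (s (it n x) - 0))) => //.
    + by rewrite p0 it0 !subrr.
    move=> y; rewrite subr0 (le_trans (sk _ _))// distrC.
    rewrite (le_trans (ler_wpM2l (ltW k0) (fP y n)))// le_eqVlt.
    by apply/orP; left; apply/eqP; ring.
  have := fP x n.+1; rewrite exprS.
  have -> : z + prim (s \o f) x - f x =
    (prim (s \o f) x - (it n.+1 x - z)) + (it n.+1 x - f x) by ring.
  move=> h; rewrite (le_trans (ler_normD _ _))// (le_trans (lerD pit h))// le_eqVlt.
  by apply/orP; left; apply/eqP; field.
exists f; first by rewrite -fE p0 addr0.
move=> x; have -> : f = (fun x => z + prim (s \o f) x) by apply/funext => y; rewrite fE.
rewrite fE -[s _]add0r; apply: is_derive1D => //; exact: is_derive_cst.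
Unshelve. all: by end_near. Qed.

Definition solution f := forall x, is_derive x 1 f (s (f x)).

Lemma solution_dependence f g : solution f -> solution g ->
  forall x, `|f x - g x| <= `|f 0 - g 0| * expR (k * `|x|).
Proof.
move=> fs gs; apply: (@gronwall R _ (fun x => s (f x) - s (g x))) => //.
  exact: ltW.
by move=> x; apply: is_derive1B.
Qed.

Lemma solution_shift f c : solution f -> solution (fun x => f (x + c)).
Proof. by move=> fs x; apply: is_derive1_shift. Qed.

Lemma solution_unique f g c : solution f -> solution g -> f c = g c -> f = g.
Proof.
move=> fs gs fgc; apply/funext => x.
have := solution_dependence (solution_shift c fs) (solution_shift c gs) (x - c).
rewrite !subrK add0r fgc subrr normr0 mul0r => h.
by apply/eqP; rewrite -subr_eq0 -normr_eq0 eq_le h normr_ge0.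
Qed.

(** To the right of its last nonnegative time a solution [f] satisfies
  [f' >= s 0 + k f >= k f], so it cannot become negative. *)
Lemma solution_ge0 f : solution f -> 0 <= s 0 -> 0 <= f 0 ->
  forall x, 0 <= x -> 0 <= f x.
Proof.
move=> fs s0 f0 x x0; rewrite leNgt; apply/negP => fx.
have cf : continuous f := is_derive_continuous fs.
have [c /andP[c0 cx] [fc neg]] : exists2 c, 0 <= c <= x &
    f c = 0 /\ forall y, c < y < x -> f y <= 0.
  pose A := [set y | 0 <= y <= x /\ 0 <= f y].
  have A0 : A 0 by rewrite /A/= lexx x0.
  have Ax : ubound A x by move=> y [/andP[]].
  have hA : has_sup A by split; [exists 0|exists x].
  have c0 : 0 <= sup A by apply: ub_le_sup => //; exists x.
  have cx : sup A <= x by apply: ge_sup => //; exists 0.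
  have neg y : sup A < y <= x -> f y < 0.
    move=> /andP[cy yx]; rewrite ltNge; apply/negP => fy.
    have : y <= sup A.
      apply: ub_le_sup; first by exists x.
      by split => //; rewrite yx (le_trans c0 (ltW cy)).
    by rewrite leNgt cy.
  exists (sup A); first by rewrite c0.
  split; last by move=> y /andP[cy /ltW yx]; apply/ltW/neg/andP.
  apply/eqP; rewrite eq_le; apply/andP; split; last first.
    rewrite leNgt; apply/negP => fcneg.
    have [e e0 he] := continuous_near_point (sup A) cf (ltac:(by rewrite oppr_gt0) : 0 < - f (sup A)).
    have [y Ay] := sup_adherent e0 hA.
    move=> yc; have yle : y <= sup A by apply: ub_le_sup => //; exists x.
    have : `|f y - f (sup A)| < - f (sup A).
      by apply: he; rewrite ler0_norm ?subr_le0//; lra.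
    by have := Ay.2; rewrite ltr_norml; lra.
  rewrite leNgt; apply/negP => fcpos.
  have cltx : sup A < x.
    by rewrite lt_neqAle cx andbT; apply/eqP => cE; move: fcpos; rewrite cE; lra.
  have [e e0 he] := continuous_near_point (sup A) cf fcpos.
  pose y := Num.min x (sup A + e / 2).
  have cy : sup A < y by rewrite lt_min cltx ltrDl divr_gt0.
  have : `|f y - f (sup A)| < f (sup A).
    apply: he; rewrite ger0_norm ?subr_ge0; last exact: ltW.
    by rewrite ltrBlDl gt_min; apply/orP; right; lra.
  have : f y < 0 by apply: neg; rewrite cy ge_min lexx.
  by rewrite ltr_norml; lra.
pose F y := f y * expR (- k * y).
have Fd y : is_derive y 1 F (s (f y) * expR (- k * y) + f y * (- k * expR (- k * y))).
  by apply: is_derive1M => //; exact: is_derive1_expR.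
have : F c <= F x.
  apply: (nondecreasing_of_derive Fd cx) => y ycx.
  rewrite mulrCA mulrA -mulrDl mulr_ge0 ?expR_ge0//.
  have := sk (f y) 0; rewrite subr0 (ler0_norm (neg _ ycx)) ler_norml; lra.
by rewrite /F fc mul0r leNgt nmulr_rlt0// expR_gt0.
Qed.

End picard.
End flow.

(** * Running maxima and reflection *)

Section running_maximum.
Context {R : realType}.
Implicit Types (f : R -> R) (s t : R).

(** Processes are only known on [[0, 1]]; composing with [clamp] continues them by
  constants, which makes their paths continuous on the whole line. *)
Definition clamp t : R := Num.max 0 (Num.min t 1).

Lemma clamp_itv t : 0 <= clamp t <= 1.
Proof.
by rewrite /clamp; case: (leP t 1) => t1; [case: (leP 0 t)|case: (leP 0 1)]; lra.
Qed.

Lemma clamp_id t : 0 <= t <= 1 -> clamp t = t.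
Proof.
rewrite /clamp => /andP[t0 t1]; case: (leP t 1) => [_|]; last lra.
by case: (leP 0 t) => //; lra.
Qed.

Lemma clamp_homo s t : s <= t -> clamp s <= clamp t.
Proof.
rewrite /clamp => st; rewrite ge_max; apply/andP; split.
  by rewrite le_max lexx.
by rewrite le_max; apply/orP; right; rewrite le_min !ge_min st lexx orbT.
Qed.

Lemma clamp_lipschitz s t : `|clamp s - clamp t| <= 1 * `|s - t|.
Proof.
rewrite mul1r; wlog st : s t / s <= t => [H|].
  by have [/H//|/ltW/H] := leP s t; rewrite distrC (distrC s).
rewrite ler0_norm ?subr_le0 ?clamp_homo// ler0_norm ?subr_le0//.
rewrite /clamp; case: (leP s 1) => s1; case: (leP t 1) => t1;
  try case: (leP 0 s) => ?; try case: (leP 0 t) => ?; try case: (leP 0 1) => ?; lra.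
Qed.

Lemma clamp_continuous : continuous clamp.
Proof. exact: lipschitz_continuous clamp_lipschitz. Qed.

Definition runmax f t : R := sup [set f s | s in `[0, t]].

Lemma runmax_attained f t : continuous f -> 0 <= t ->
  exists2 s, 0 <= s <= t & runmax f t = f s /\
    forall u, 0 <= u <= t -> f u <= f s.
Proof.
move=> cf t0.
have [s st smax] := EVT_max t0 (continuous_subspaceT cf).
exists s; first by rewrite in_itv/= in st.
have ub u : 0 <= u <= t -> f u <= f s by move=> ut; apply: smax; rewrite in_itv.
split=> //; apply/eqP; rewrite eq_le; apply/andP; split.
  apply: ge_sup; first by exists (f s), s.
  by move=> _ [u ut <-]; apply: ub; move: ut; rewrite /= in_itv.
apply: ub_le_sup; last by exists s.
by exists (f s) => _ [u ut <-]; apply: ub; move: ut; rewrite /= in_itv.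
Qed.

Lemma runmax_ge f s t : continuous f -> 0 <= s <= t -> f s <= runmax f t.
Proof.
move=> cf /andP[s0 st]; have [u _ [-> h]] := runmax_attained cf (le_trans s0 st).
by apply: h; rewrite s0.
Qed.

Lemma runmax_homo f s t : continuous f -> 0 <= s -> s <= t ->
  runmax f s <= runmax f t.
Proof.
move=> cf s0 st; have [u /andP[u0 us] [-> _]] := runmax_attained cf s0.
by apply: runmax_ge => //; rewrite u0 (le_trans us).
Qed.

Lemma runmax_clamp_continuous f : continuous f ->
  continuous (fun t => runmax f (clamp t)).
Proof.
move=> cf.
suff H (t e : R) : 0 <= t -> 0 < e -> exists2 d : R, 0 < d & forall u : R, 0 <= u ->
    `|u - t| < d -> `|runmax f u - runmax f t| < e.
  move=> t; apply/cvgrPdist_lt => e e0.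
  have /andP[ct0 _] := clamp_itv t.
  have [d d0 hd] := H (clamp t) e ct0 e0.
  near=> u; rewrite distrC; apply: hd; first by have /andP[] := clamp_itv u.
  rewrite (le_lt_trans (clamp_lipschitz _ _))// mul1r distrC.
  by near: u; apply: (@cvgr_dist_lt _ _ R _ _ id t).
move=> t0 e0.
have e2 : 0 < e / 3 by rewrite divr_gt0.
have [d d0 hd] := continuous_near_point t cf e2.
exists d => // u u0 ut.
have [v /andP[v0 vt] [Mt _]] := runmax_attained cf t0.
have [v' /andP[v'0 v'u] [Mu _]] := runmax_attained cf u0.
have [tu|ut'] := leP t u.
  have := runmax_homo cf t0 tu; rewrite ltr_norml.
  suff : f v' <= runmax f t + e / 3 by lra.
  have [v't|tv'] := leP v' t.
    by have : f v' <= runmax f t by [apply: runmax_ge => //; rewrite v'0]; lra.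
  have : `|f v' - f t| < e / 3.
    by apply: hd; move: ut; rewrite !ger0_norm; lra.
  have : f t <= runmax f t by apply: runmax_ge => //; rewrite t0 lexx.
  by rewrite ltr_norml; lra.
have := runmax_homo cf u0 (ltW ut'); rewrite ltr_norml.
suff : f v < runmax f u + e by lra.
have [vu|uv] := leP v u.
  by have : f v <= runmax f u by [apply: runmax_ge => //; rewrite v0]; lra.
have : `|f v - f t| < e / 3.
  by apply: hd; move: ut; rewrite !ler0_norm; lra.
have := hd _ ut.
have : f u <= runmax f u by apply: runmax_ge => //; rewrite u0 lexx.
by rewrite !ltr_norml; lra.
Unshelve. all: by end_near. Qed.

(** The Skorokhod push grows only when a new maximum [r] of [f] is reached; there
  the pushed path [- f + push] sits at the level [- a]. *)
Lemma push_growth f a s t : continuous f -> 0 <= s -> s <= t ->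
  Num.max 0 (runmax f s - a) < Num.max 0 (runmax f t - a) ->
  exists2 r, s <= r <= t & - f r + Num.max 0 (runmax f r - a) = - a.
Proof.
move=> cf s0 st lt_st.
have tpos : 0 < runmax f t - a.
  rewrite ltNge; apply/negP => h; move: lt_st; rewrite (max_l h).
  by rewrite ltNge le_max lexx.
move: lt_st; rewrite (max_r (ltW tpos)) gt_max => /andP[_ sltt].
have [r /andP[r0 rt] [Mt _]] := runmax_attained cf (le_trans s0 st).
have sr : s <= r.
  rewrite leNgt; apply/negP => rs.
  have : f r <= runmax f s by apply: runmax_ge => //; rewrite r0 ltW.
  lra.
exists r; first by rewrite sr.
have Mr : runmax f r = f r.
  apply/eqP; rewrite eq_le runmax_ge ?r0 ?lexx// andbT -Mt.
  exact: runmax_homo.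
rewrite Mr max_r; last by rewrite -Mt ltW.
ring.
Qed.

End running_maximum.

Section reflection_time.
Context {R : realType}.
Variables (s : R -> R) (k : R).
Hypotheses (k0 : 0 < k) (sk : forall x y, `|s x - s y| <= k * `|x - y|).
Variable phi : R -> R -> R.
Hypotheses (phi0 : forall z, phi z 0 = z) (phis : forall z, solution s (phi z)).

Lemma phi_cst z : s z = 0 -> phi z = cst z.
Proof.
move=> sz; apply: (solution_unique k0 sk (phis z) (c := 0)); last by rewrite phi0.
by move=> x; rewrite sz; exact: is_derive_cst.
Qed.

Lemma phi_shift a z : phi 0 a = z -> forall u, phi z u = phi 0 (u + a).
Proof.
move=> az u; have E : phi z = (fun x => phi 0 (x + a)).
  apply: (solution_unique k0 sk (phis z) (c := 0)).
    exact: (solution_shift a (phis 0)).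
  by rewrite phi0 add0r.
by rewrite E.
Qed.

(** The speed [s (phi 0 x)] keeps its sign: at a zero of [s] the solution would
  be constant, by uniqueness. *)
Lemma phi0_increasing : 0 < s 0 -> forall x y, x < y -> phi 0 x < phi 0 y.
Proof.
move=> s0.
have cs : continuous s := lipschitz_continuous sk.
have cphi : continuous (phi 0) := is_derive_continuous (phis 0).
have csp : continuous (fun x => s (phi 0 x)).
  by move=> x; apply: continuous_comp; [exact: cphi|exact: cs].
have nz x : s (phi 0 x) != 0.
  apply/eqP => /phi_cst E.
  have {}E : phi 0 = cst (phi 0 x).
    by rewrite -E; apply: (solution_unique k0 sk (phis 0) (phis _) (c := x)); rewrite E.
  have := is_derive_cst (phi 0 x) (0 : R) (1 : R); rewrite -E => /@derive_val.
  have /@derive_val -> := phis 0 0.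
  by rewrite phi0 => s00; move: s0; rewrite s00 ltxx.
have pos x : 0 < s (phi 0 x).
  rewrite ltNge; apply/negP => h.
  have [xx|xx] := leP 0 x.
    have [|c _] := @IVT R (fun x => s (phi 0 x)) 0 x 0 xx (continuous_subspaceT csp).
      by rewrite phi0 (min_r (le_trans h (ltW s0))) h le_max (ltW s0).
    by apply/eqP/nz.
  have [|c _] := @IVT R (fun x => s (phi 0 x)) x 0 0 (ltW xx) (continuous_subspaceT csp).
    by rewrite phi0 ge_min h le_max (ltW s0) orbT.
  by apply/eqP/nz.
move=> x y xy; have [c _ ] := mean_value (phis 0) (ltW xy).
by rewrite -subr_gt0 => ->; rewrite mulr_gt0 ?subr_gt0.
Qed.

(** Since [0] is stationary, [solution_ge0] applies in both directions of time. *)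
Lemma phi_ge0_of_stationary z : s 0 = 0 -> 0 <= z -> forall u, 0 <= phi z u.
Proof.
move=> s0 z0 u; have [u0|u0] := leP 0 u.
  by apply: (solution_ge0 sk (phis z)) => //; rewrite ?s0 ?phi0.
have sk' x y : `|- s x - - s y| <= k * `|x - y| by rewrite -opprD normrN.
have := @solution_ge0 _ (fun x => - s x) k sk' (fun u => phi z (- u)) _ _ _ (- u).
rewrite s0 !oppr0 phi0 opprK; apply => //; last by rewrite oppr_ge0 ltW.
by move=> x; exact: (is_derive1_opp (phis z (- x))).
Qed.

(** A solution through [z] that was [0] at an earlier time [c] would be the
  solution through [0] shifted by [c], which reaches [z] at the time [- c]. *)
Lemma phi_ge0_of_unreached z : 0 <= s 0 -> 0 <= z ->
  (forall r, 0 <= r -> phi 0 r != z) -> forall u, 0 <= phi z u.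
Proof.
move=> s0 z0 nr u; have [u0|u0] := leP 0 u.
  by apply: (solution_ge0 sk (phis z)) => //; rewrite phi0.
rewrite leNgt; apply/negP => pu.
have cphi : continuous (phi z) := is_derive_continuous (phis z).
have [|c] := @IVT R (phi z) u 0 0 (ltW u0) (continuous_subspaceT cphi).
  by rewrite phi0 ge_min (ltW pu) le_max z0 orbT.
rewrite in_itv/= => /andP[_ c0] pc.
suff : phi 0 (- c) = z by apply/eqP/nr; rewrite oppr_ge0.
have E : phi z = (fun x => phi 0 (x + - c)).
  apply: (solution_unique k0 sk (phis z) (c := c)).
    exact: (solution_shift (- c) (phis 0)).
  by rewrite subrr phi0.
by rewrite -[RHS](phi0 z) E add0r.
Qed.

(** [rho z m] is the time [max 0 (m - a)] gained by reflection when a path that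
  starts from [z] has been driven down by [m]; [a] is the time that the flow
  needs from [0] to [z], and no reflection happens when [z] is out of reach.
  The last clause describes [rho] without [a] and yields measurability. *)
Lemma ex_reflection_time : 0 <= s 0 -> exists rho : R -> R -> R,
  forall z, 0 <= z ->
  [/\ (exists2 a : R, 0 <= a & [/\ phi z (- a) = 0,
        (forall u : R, - a <= u -> 0 <= phi z u) &
        forall m, rho z m = Num.max 0 (m - a)]) \/
      ((forall u, 0 <= phi z u) /\ forall m, rho z m = 0) &
      forall m c : R, 0 <= c ->
        c < rho z m <-> [/\ 0 < s 0, c < m & z < phi 0 (m - c)]].
Proof.
move=> s0.
have [sz|snz] := eqVneq (s 0) 0.
  exists (fun _ _ => 0) => z z0; split.
    by right; split => //; exact: phi_ge0_of_stationary.
  by move=> m c c0; split => [|[]]; [lra|rewrite sz ltxx].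
have {snz} s1 : 0 < s 0 by rewrite lt_neqAle eq_sym snz.
have inc := phi0_increasing s1.
have cphi : continuous (phi 0) := is_derive_continuous (phis 0).
suff /choice[rho H] : forall z, exists r : R -> R, 0 <= z ->
  [/\ (exists2 a : R, 0 <= a & [/\ phi z (- a) = 0,
        (forall u : R, - a <= u -> 0 <= phi z u) &
        forall m, r m = Num.max 0 (m - a)]) \/
      ((forall u, 0 <= phi z u) /\ forall m, r m = 0) &
      forall m c : R, 0 <= c ->
        c < r m <-> [/\ 0 < s 0, c < m & z < phi 0 (m - c)]].
  by exists rho.
move=> z; have [[a a0 az]|na] := pselect (exists2 a : R, 0 <= a & phi 0 a = z).
  exists (fun m => Num.max 0 (m - a)) => z0; split.
    left; exists a => //; have E := phi_shift az.
    split=> [|u au|//]; first by rewrite E addNr phi0.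
    rewrite E; apply: (solution_ge0 sk (phis 0)) => //; first by rewrite phi0.
    by rewrite -lerBlDr sub0r.
  move=> m c c0; rewrite lt_max ltNge c0/=; split => [cma|[_ cm]].
    split=> //; first lra.
    by rewrite -az; apply: inc; lra.
  rewrite -az => h; rewrite ltrBrDl -ltrBrDr ltNge; apply/negP; rewrite le_eqVlt.
  by case/predU1P => [E|/inc]; [move: h; rewrite E ltxx|move: h; lra].
have na' r : 0 <= r -> phi 0 r != z by move=> r0; apply/eqP => rz; apply: na; exists r.
exists (fun => 0) => z0; split.
  by right; split => //; apply: phi_ge0_of_unreached.
move=> m c c0; split=> [|[_ cm h]]; first lra.
exfalso.
have mc : 0 <= m - c by lra.
have [|r] := @IVT R (phi 0) 0 (m - c) z mc (continuous_subspaceT cphi).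
  by rewrite phi0 ge_min z0 le_max (ltW h) orbT.
by rewrite in_itv/= => /andP[r0 _]; apply/eqP/na'.
Qed.

End reflection_time.

(** * Averages over segments *)

Lemma big_ord_cond_recr (V : nmodType) n (J : pred nat) (f : nat -> V) :
  \sum_(k < n.+1 | J k) f k =
  \sum_(k < n | J k) f k + (if J n then f n else 0).
Proof. by rewrite !(big_mkcond (fun k : 'I__ => J k)) big_ord_recr. Qed.

Section segment_average.
Context {R : realType}.
Implicit Types (f g : R -> R).
Local Notation mu := (@lebesgue_measure R).

Lemma Rintegral_of_primitive (F f : R -> R) (a b : R) : a <= b ->
  continuous f -> (forall x : R, is_derive x 1 F (f x)) ->
  \int[mu]_(x in `[a, b]) f x = F b - F a.
Proof.
move=> + cf Fd; rewrite le_eqVlt => /predU1P[->|ab].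
  by rewrite set_itv1 Rintegral_set1 subrr.
rewrite /Rintegral (@continuous_FTC2 _ f F)//.
- exact: continuous_subspaceT.
- split => [x _||]; first by have [] := Fd x.
  + by apply: cvg_at_right_filter; exact: (is_derive_continuous Fd).
  + by apply: cvg_at_left_filter; exact: (is_derive_continuous Fd).
- by move=> x _; rewrite derive1E; have [] := Fd x.
Qed.

(** Averages over cells are rescaled to the unit segment, so that the cells of a
  partition share one integration variable, to be exchanged with expectation. *)
Definition avg f (a c : R) : R := \int[mu]_(th in `[0, 1]) f (a + th * (c - a)).

Lemma continuous_affine_comp f (a c : R) : continuous f ->
  continuous (fun th : R => f (a + th * (c - a))).
Proof.
move=> cf x; apply: (@continuous_comp R R R (fun th => a + th * (c - a)) f); last exact: cf.
by apply: cvgD; [exact: cvg_cst|apply: cvgM; [exact: cvg_id|exact: cvg_cst]].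
Qed.

Lemma avgE f (a c : R) : continuous f -> a < c ->
  (c - a)^-1 * \int[mu]_(x in `[a, c]) f x = avg f a c.
Proof.
move=> cf ac; have [F _ Fd] := ex_primitive cf.
rewrite /avg (@Rintegral_of_primitive F)//; last exact: ltW.
have Hd (x : R) : is_derive x 1 (fun th => (c - a)^-1 * F (a + th * (c - a)))
    (f (a + x * (c - a))).
  have ad : is_derive x 1 (fun th : R => a + th * (c - a)) (c - a).
    have := is_derive1D (is_derive_cst a x 1)
      (is_derive1M (is_derive_id x 1) (is_derive_cst (c - a) x 1)).
    by rewrite add0r mul1r mulr0 addr0.
  have := is_derive1Zl (c - a)^-1 (is_derive1_comp (Fd _) ad).
  by rewrite mulrCA mulVf ?mulr1// subr_eq0 gt_eqF.
rewrite (Rintegral_of_primitive ler01 _ Hd); last exact: continuous_affine_comp.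
by rewrite mul1r mul0r addr0 subrKC mulrBr.
Qed.

Lemma unit_integrable f : continuous f -> mu.-integrable `[0, 1] (EFin \o f).
Proof. exact: continuous_integrable_segment. Qed.

Lemma unit_Rintegral_cst (r : R) : \int[mu]_(th in `[0, 1]) r = r.
Proof.
rewrite Rintegral_cst//= lebesgue_measure_itv/= lte01 oppr0 adde0 /= mulr1//.
Qed.

Lemma unit_le_Rintegral f g : continuous f -> continuous g ->
  (forall th, 0 <= th <= 1 -> f th <= g th) ->
  \int[mu]_(th in `[0, 1]) f th <= \int[mu]_(th in `[0, 1]) g th.
Proof.
move=> cf cg fg; apply: le_Rintegral => //; try exact: unit_integrable.
Qed.

Lemma unit_norm_le_Rintegral f g : continuous f -> continuous g ->
  (forall th, 0 <= th <= 1 -> `|f th| <= g th) ->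
  `|\int[mu]_(th in `[0, 1]) f th| <= \int[mu]_(th in `[0, 1]) g th.
Proof.
move=> cf cg fg; apply: (le_trans (le_normr_Rintegral _ _)) => //.
  exact: unit_integrable.
apply: unit_le_Rintegral => //.
by move=> x; apply: continuous_comp; [exact: cf|exact: norm_continuous].
Qed.

Lemma unit_RintegralD f g : continuous f -> continuous g ->
  \int[mu]_(th in `[0, 1]) (f th + g th) =
  \int[mu]_(th in `[0, 1]) f th + \int[mu]_(th in `[0, 1]) g th.
Proof. by move=> cf cg; apply: RintegralD => //; exact: unit_integrable. Qed.

Lemma unit_RintegralZl f (r : R) : continuous f ->
  \int[mu]_(th in `[0, 1]) (r * f th) = r * \int[mu]_(th in `[0, 1]) f th.
Proof. by move=> cf; apply: RintegralZl => //; exact: unit_integrable. Qed.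

Lemma unit_Rintegral_affine f g (x y z : R) : continuous f -> continuous g ->
  \int[mu]_(th in `[0, 1]) (x * f th + y * g th + z) =
  x * \int[mu]_(th in `[0, 1]) f th + y * \int[mu]_(th in `[0, 1]) g th + z.
Proof.
move=> cf cg; have cc := @continuous_const R.
have cx := continuous_mul (cc x) cf; have cy := continuous_mul (cc y) cg.
rewrite unit_RintegralD ?unit_Rintegral_cst//; last exact: continuous_add.
by rewrite unit_RintegralD// !unit_RintegralZl.
Qed.

Lemma continuous_sumn n (P : pred nat) (h : nat -> R -> R) :
  (forall i, continuous (h i)) ->
  continuous (fun x => \sum_(i < n | P i) h i x).
Proof.
move=> ch; elim: n => [|n IH] x.
  rewrite (_ : (fun _ => _) = cst 0); first exact: cvg_cst.
  by apply/funext => y; rewrite big_ord0.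
have -> : (fun x => \sum_(i < n.+1 | P i) h i x) =
    (fun x => \sum_(i < n | P i) h i x + (if P n then h n x else 0)).
  by apply/funext => y; rewrite (big_ord_cond_recr _ _ (fun i => h i y)).
by case: (P n); apply: cvgD; [exact: IH|exact: ch|exact: IH|exact: cvg_cst].
Qed.

Lemma unit_Rintegral_sum n (P : pred nat) (h : nat -> R -> R) :
  (forall i, continuous (h i)) ->
  \int[mu]_(th in `[0, 1]) (\sum_(i < n | P i) h i th) =
  \sum_(i < n | P i) \int[mu]_(th in `[0, 1]) h i th.
Proof.
move=> ch; elim: n => [|n IH].
  by rewrite big_ord0 (_ : (fun _ => _) = fun=> 0) ?unit_Rintegral_cst//;
    apply/funext => y; rewrite big_ord0.
have -> : (fun x => \sum_(i < n.+1 | P i) h i x) =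
    (fun x => \sum_(i < n | P i) h i x + (if P n then h n x else 0)).
  by apply/funext => y; rewrite (big_ord_cond_recr _ _ (fun i => h i y)).
rewrite unit_RintegralD; last 2 first.
- exact: continuous_sumn.
- by case: (P n); [exact: ch|exact: cst_continuous].
rewrite IH (big_ord_cond_recr _ _ (fun i => \int[mu]_(th in `[0, 1]) h i th)).
by case: (P n) => //; rewrite unit_Rintegral_cst.
Qed.

(** The compensators [c - s] and [s - a] of the two squares in [sqdiff] have the
  same average over [s]; this is where averaging the integrand, rather than
  evaluating it at an end point, removes the Ito correction. *)
Lemma unit_Rintegral_symmetric (d : R) :
  \int[mu]_(th in `[0, 1]) ((1 - th) * d - th * d) = 0.
Proof.
have Hd (x : R) : is_derive x 1 (fun th : R => d * (th - th * th))
    ((1 - x) * d - x * d).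
  have := is_derive1Zl d (is_derive1B (is_derive_id x (1 : R))
    (is_derive1M (is_derive_id x (1 : R)) (is_derive_id x (1 : R)))).
  by move=> H; apply: (is_derive_eq H); ring.
rewrite (Rintegral_of_primitive ler01 _ Hd); first by ring.
move=> x; apply: cvgB; apply: cvgM; try exact: cvg_cst; last exact: cvg_id.
by apply: cvgB; [exact: cvg_cst|exact: cvg_id].
Qed.

End segment_average.

(** * The pathwise error of averaged sums *)

Section pathwise_estimate.
Context {R : realType}.
Implicit Types b r : R -> R.

Definition sqdiff b (a s c : R) := (b c - b s) ^+ 2 - (b s - b a) ^+ 2.
Definition sqsum b (a s c : R) := (b c - b s) ^+ 2 + (b s - b a) ^+ 2.

(** Expanding [G] from the intermediate point [s] to both ends cancels the second
  order term up to [sqdiff]. The growth of [r] contributes [s0] times its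
  increment, because it takes place where [g] is close to [s0]; the squares of
  the increments of [b + r] and of [b] differ by multiples of [eta * (r c - r a)]. *)
Lemma pointwise_expansion (G g g1 b r : R -> R) (a s c s0 eta C Kc : R) :
  (forall x : R, is_derive x 1 G (g x)) ->
  (forall x : R, is_derive x 1 g (g1 x)) ->
  continuous b -> continuous r -> a <= s <= c -> 0 <= eta <= 1 ->
  r a <= r s <= r c -> r c - r a <= eta ->
  `|b c - b s| <= eta -> `|b s - b a| <= eta -> `|C| <= Kc ->
  (forall x, a <= x <= c -> `|g1 (b x + r x) - C| <= eta) ->
  `|g (b s + r s) - s0| * (r c - r a) <= eta * (r c - r a) ->
  `|g (b s + r s) * (b c - b a)
    - (G (b c + r c) - G (b a + r a) - s0 * (r c - r a))
    + 2^-1 * C * sqdiff b a s c|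
  <= eta * sqsum b a s c + (2 * Kc + 4) * (eta * (r c - r a)).
Proof.
move=> Gd gd cb cr /andP[as_ sc] /andP[eta0 eta1] /andP[ras rsc] rca bcs bsa CK g1C gs0.
pose U x := b x + r x.
have cU : continuous U by move=> x; apply: cvgD; [exact: cb|exact: cr].
have step x : a <= x <= c -> x = a \/ x = c -> `|G (U x) - G (U s) -
    g (U s) * (U x - U s) - 2^-1 * C * (U x - U s) ^+ 2| <= eta * (U x - U s) ^+ 2.
  move=> axc xac; apply: second_order_expansion => // y yU.
  have [z zs <-] : exists2 z, a <= z <= c & U z = y.
    case: xac => xE; rewrite {}xE in axc yU *.
      have [|z] := @IVT R U a s y as_ (continuous_subspaceT cU).
        by rewrite minC maxC.
      by rewrite in_itv/= => /andP[az zs] <-; exists z => //; rewrite az (le_trans zs).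
    have [|z] := @IVT R U s c y sc (continuous_subspaceT cU); first exact: yU.
    by rewrite in_itv/= => /andP[az zs] <-; exists z => //; rewrite zs (le_trans as_).
  exact: g1C.
have ac : a <= c := le_trans as_ sc.
have e1 := step c ltac:(by rewrite ac lexx) (or_intror erefl).
have e2 := step a ltac:(by rewrite ac lexx) (or_introl erefl).
rewrite /U in e1 e2.
set e1' := (X in `|X| <= _) in e1; set e2' := (X in `|X| <= _) in e2.
set xb := b c - b s in bcs; set yb := b s - b a in bsa.
set p := r c - r s; set q := r s - r a.
have p0 : 0 <= p by rewrite subr_ge0.
have q0 : 0 <= q by rewrite subr_ge0.
have pq : r c - r a = p + q by rewrite /p /q; ring.
rewrite pq in rca gs0 *.
have Ux : b c + r c - (b s + r s) = xb + p by rewrite /xb /p; ring.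
have Uy : b a + r a - (b s + r s) = - (yb + q) by rewrite /yb /q; ring.
have dx : `|(xb + p) ^+ 2 - xb ^+ 2| <= 3 * (eta * p).
  have -> : (xb + p) ^+ 2 - xb ^+ 2 = (2 * xb + p) * p by ring.
  rewrite normrM (ger0_norm p0) mulrA ler_wpM2r//.
  by move: bcs; rewrite !ler_norml; lra.
have dy : `|(yb + q) ^+ 2 - yb ^+ 2| <= 3 * (eta * q).
  have -> : (yb + q) ^+ 2 - yb ^+ 2 = (2 * yb + q) * q by ring.
  rewrite normrM (ger0_norm q0) mulrA ler_wpM2r//.
  by move: bsa; rewrite !ler_norml; lra.
have Kc0 : 0 <= Kc := le_trans (normr_ge0 _) CK.
have cmp u v w : 0 <= w -> `|u - v| <= 3 * (eta * w) -> 0 <= v ->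
   `|2^-1 * C * (u - v)| <= 2^-1 * Kc * (3 * (eta * w)) /\
   eta * u <= eta * v + 3 * (eta * w).
  move=> w0 uv v0; split.
    rewrite normrM; apply: ler_pM => //.
    by rewrite normrM ger0_norm ?invr_ge0//; apply: ler_wpM2l.
  have ew : 0 <= eta * w by apply: mulr_ge0.
  have : eta * (u - v) <= 3 * (eta * w).
    have h1 : u - v <= 3 * (eta * w) := le_trans (ler_norm _) uv.
    apply: (le_trans (ler_wpM2l eta0 h1)).
    by apply: ler_piMl => //; lra.
  by lra.
have [cx1 cx2] := cmp _ _ _ p0 dx (sqr_ge0 _).
have [cy1 cy2] := cmp _ _ _ q0 dy (sqr_ge0 _).
rewrite Ux in e1; rewrite Uy sqrrN in e2.
have e3 : `|(g (b s + r s) - s0) * (p + q)| <= eta * (p + q).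
  by rewrite normrM (ger0_norm (addr_ge0 p0 q0)).
have -> : g (b s + r s) * (b c - b a) -
    (G (b c + r c) - G (b a + r a) - s0 * (p + q)) + 2^-1 * C * sqdiff b a s c
  = - e1' + e2' - (g (b s + r s) - s0) * (p + q)
    - 2^-1 * C * ((xb + p) ^+ 2 - xb ^+ 2) + 2^-1 * C * ((yb + q) ^+ 2 - yb ^+ 2).
  by rewrite /e1' /e2' /sqdiff Ux Uy /xb /yb /p /q; ring.
have ep : 0 <= Kc * (eta * p) by rewrite !mulr_ge0.
have eq_ : 0 <= Kc * (eta * q) by rewrite !mulr_ge0.
have -> : sqsum b a s c = xb ^+ 2 + yb ^+ 2 by [].
move: e1 e2 e3 cx1 cx2 cy1 cy2.
move: (2^-1 * C * ((xb + p) ^+ 2 - xb ^+ 2)) (2^-1 * C * ((yb + q) ^+ 2 - yb ^+ 2)) => A1 A2.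
move: ((g (b s + r s) - s0) * (p + q)) => A3.
rewrite !ler_norml !mulrDr !mulrDl.
move: (eta * (xb + p) ^+ 2) (eta * (yb + q) ^+ 2) (eta * xb ^+ 2) (eta * yb ^+ 2) => B1 B2 B3 B4.
rewrite -!mulrA; move: (eta * p) (eta * q) ep eq_ => F1 F2.
rewrite !(mulrCA Kc); move: (Kc * F1) (Kc * F2) => K1 K2; lra.
Qed.

End pathwise_estimate.

Section partitions.
Context {R : realType}.
Implicit Types (t : R) (p : seq R).

Lemma pt_lt t p k : itv_partition 0 t p -> (k < size p)%N ->
  pt p k < pt p k.+1.
Proof. by move=> [/(pathP 0) h _] kp; exact: h. Qed.

Lemma pt_last t p : itv_partition 0 t p -> pt p (size p) = t.
Proof. by move=> [_ /eqP <-]; rewrite /pt -last_nth. Qed.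

Lemma pt_le t p i j : itv_partition 0 t p -> (i <= j)%N -> (j <= size p)%N ->
  pt p i <= pt p j.
Proof.
move=> pp; elim: j => [|j IH]; first by rewrite leqn0 => /eqP->.
rewrite leq_eqVlt => /predU1P[->//|ij jp].
by rewrite (le_trans (IH _ (ltnW jp)))// ltW// (pt_lt pp).
Qed.

Lemma pt_itv t p k : itv_partition 0 t p -> (k <= size p)%N -> 0 <= pt p k <= t.
Proof.
by move=> pp kp; rewrite (pt_le (i := 0) pp)//= -(pt_last pp) (pt_le pp).
Qed.

Lemma mesh_ge p k : (k < size p)%N -> pt p k.+1 - pt p k <= mesh p.
Proof. by move=> kp; exact: (le_bigmax _ (fun k : 'I__ => _) (Ordinal kp)). Qed.

Lemma sum_increments t p (h : R -> R) : itv_partition 0 t p ->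
  \sum_(k < size p) (h (pt p k.+1) - h (pt p k)) = h t - h 0.
Proof.
move=> pp; rewrite -(big_mkord xpredT (fun k => h (pt p k.+1) - h (pt p k))).
by rewrite telescope_sumr// (pt_last pp).
Qed.

End partitions.

Section pathwise_error.
Context {R : realType}.
Local Notation mu := (@lebesgue_measure R).
Implicit Types b r : R -> R.

Lemma sqdiff_continuous b a c : continuous b -> continuous (fun s => sqdiff b a s c).
Proof.
by move=> cb; apply: continuous_sub; apply: continuous_sqr;
  apply: continuous_sub => //; exact: continuous_const.
Qed.

Lemma sqsum_continuous b a c : continuous b -> continuous (fun s => sqsum b a s c).
Proof.
by move=> cb; apply: continuous_add; apply: continuous_sqr;
  apply: continuous_sub => //; exact: continuous_const.
Qed.

Lemma affine_itv (a c th : R) : a <= c -> 0 <= th <= 1 ->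
  a <= a + th * (c - a) <= c.
Proof.
move=> ac /andP[th0 th1]; rewrite lerDl mulr_ge0 ?subr_ge0//=.
by rewrite -lerBrDl -[leRHS]mul1r ler_wpM2r// subr_ge0.
Qed.

Lemma avg_expansion (G g g1 b r : R -> R) (a c s0 eta C Kc : R) :
  (forall x : R, is_derive x 1 G (g x)) ->
  (forall x : R, is_derive x 1 g (g1 x)) ->
  continuous b -> continuous r -> a <= c -> 0 <= eta <= 1 -> `|C| <= Kc ->
  (forall x y, a <= x -> x <= y -> y <= c -> r x <= r y) ->
  (forall x y, a <= x <= c -> a <= y <= c ->
    [/\ `|b x - b y| <= eta, `|r x - r y| <= eta &
        `|g (b x + r x) - g (b y + r y)| <= eta]) ->
  (forall x, a <= x <= c -> `|g1 (b x + r x) - C| <= eta) ->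
  (r a < r c -> exists2 x, a <= x <= c & g (b x + r x) = s0) ->
  `|avg (fun s => g (b s + r s)) a c * (b c - b a)
    - (G (b c + r c) - G (b a + r a) - s0 * (r c - r a))
    + 2^-1 * C * avg (fun s => sqdiff b a s c) a c|
  <= eta * avg (fun s => sqsum b a s c) a c + (2 * Kc + 4) * (eta * (r c - r a)).
Proof.
move=> Gd gd cb cr ac eta01 CK rnd osc g1C grow.
have cU : continuous (fun x => b x + r x) := continuous_add cb cr.
have cgU := continuous_compose (is_derive_continuous gd) cU.
set I := G _ - _ - _; set E := (2 * Kc + 4) * _.
have cf := @continuous_affine_comp R _ a c cgU.
have cd : continuous (fun th : R => sqdiff b a (a + th * (c - a)) c).
  by apply: (@continuous_affine_comp R (fun s => sqdiff b a s c)); exact: sqdiff_continuous.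
have cq : continuous (fun th : R => sqsum b a (a + th * (c - a)) c).
  by apply: (@continuous_affine_comp R (fun s => sqsum b a s c)); exact: sqsum_continuous.
rewrite /avg.
have cc := @continuous_const R.
have cZ (z : R) f (cf0 : continuous f) := continuous_mul (cc z) cf0.
rewrite mulrC -addrA (addrC (- I)) addrA -unit_Rintegral_affine//.
rewrite -[X in _ <= X + _]addr0 -[X in _ <= _ + X + _](mul0r
  (\int[mu]_(th in `[0, 1]) sqsum b a (a + th * (c - a)) c)).
rewrite -unit_Rintegral_affine//; apply: unit_norm_le_Rintegral;
  do ?[exact: cZ|apply: continuous_add|exact: cc].
move=> th th01; have as_c := affine_itv ac th01.
have /andP[as_ sc] := as_c.
have aac : a <= a <= c by rewrite lexx.
have cac : a <= c <= c by rewrite lexx andbT.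
rewrite mul0r addr0 mulrC -addrA (addrC _ (- I)) addrA; apply: (@pointwise_expansion R G g g1) => //.
- by rewrite !rnd// ?lexx.
- by have [_ h _] := osc _ _ cac aac; apply: le_trans (ler_norm _) h.
- by have [] := osc _ _ cac as_c.
- by have [] := osc _ _ as_c aac.
have [rac|rac] := ltP (r a) (r c).
  have [x xac <-] := grow rac; rewrite ler_wpM2r ?subr_ge0 ?(ltW rac)//.
  by have [] := osc _ _ as_c xac.
have -> : r c - r a = 0 by apply/eqP; rewrite eq_le subr_le0 rac subr_ge0 rnd.
by rewrite !mulr0.
Qed.

Definition block (N : nat) (p : seq R) (k : nat) : nat :=
  Num.truncn (N%:R * pt p k).

(** The second order coefficient [g1] along the path is frozen at the left end
  of the blocks of length [1/N], so that only sums of [sqdiff] over the blocks,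
  with no random weights, remain. *)
Lemma strat_sum_error (G g g1 b r : R -> R) (s0 eta Kc t : R) (N : nat) (p : seq R) :
  (forall x : R, is_derive x 1 G (g x)) ->
  (forall x : R, is_derive x 1 g (g1 x)) ->
  continuous b -> continuous r -> 0 <= eta <= 1 -> t <= 1 -> (0 < N)%N ->
  itv_partition 0 t p -> mesh p <= N%:R^-1 ->
  (forall x y, 0 <= x -> x <= y -> y <= 1 -> r x <= r y) ->
  (forall x y, 0 <= x <= 1 -> 0 <= y <= 1 -> `|x - y| <= 2 / N%:R ->
    [/\ `|b x - b y| <= eta, `|r x - r y| <= eta,
        `|g (b x + r x) - g (b y + r y)| <= eta &
        `|g1 (b x + r x) - g1 (b y + r y)| <= eta]) ->
  (forall x, 0 <= x <= 1 -> `|g1 (b x + r x)| <= Kc) ->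
  (forall x y, 0 <= x -> x <= y -> y <= 1 -> r x < r y ->
    exists2 z, x <= z <= y & g (b z + r z) = s0) ->
  `|\sum_(k < size p) avg (fun s => g (b s + r s)) (pt p k) (pt p k.+1) *
      (b (pt p k.+1) - b (pt p k))
    - (G (b t + r t) - G (b 0 + r 0) - s0 * (r t - r 0))|
  <= Kc * \sum_(j < N.+1) `|\sum_(k < size p | block N p k == j)
        avg (fun s => sqdiff b (pt p k) s (pt p k.+1)) (pt p k) (pt p k.+1)|
     + eta * \sum_(k < size p)
        avg (fun s => sqsum b (pt p k) s (pt p k.+1)) (pt p k) (pt p k.+1)
     + (2 * Kc + 4) * (eta * (r t - r 0)).
Proof.
move=> Gd gd cb cr eta01 t1 N0 pp pmesh rnd osc g1K grow.
have N0' : 0 < N%:R :> R by rewrite ltr0n.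
pose U x := b x + r x.
pose D k := avg (fun s => sqdiff b (pt p k) s (pt p k.+1)) (pt p k) (pt p k.+1).
pose Q k := avg (fun s => sqsum b (pt p k) s (pt p k.+1)) (pt p k) (pt p k.+1).
pose S k := avg (fun s => g (b s + r s)) (pt p k) (pt p k.+1) *
      (b (pt p k.+1) - b (pt p k)).
pose I x := G (U x) - s0 * r x.
pose dr k := r (pt p k.+1) - r (pt p k).
pose c j := g1 (U (j%:R / N%:R)).
have blk k : (k < size p)%N -> (block N p k)%:R / N%:R <= pt p k /\
    pt p k < (block N p k)%:R / N%:R + N%:R^-1 /\ (block N p k < N.+1)%N.
  move=> kp; have /andP[k0 kt] := pt_itv pp (ltnW kp).
  have Nk0 : 0 <= N%:R * pt p k by rewrite mulr_ge0// ltW.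
  have /andP[h1 h2] := Num.Theory.truncn_itv Nk0.
  rewrite ler_pdivrMr// mulrC; split=> //; split.
    rewrite -[X in _ + X]mul1r -mulrDl ltr_pdivlMr// mulrC.
    by move: h2; rewrite -natr1.
  rewrite ltnS -(ler_nat R); apply: le_trans h1 _.
  by rewrite ler_piMr ?(ltW N0')// (le_trans kt).
have main k : (k < size p)%N ->
  `|S k - (I (pt p k.+1) - I (pt p k)) + 2^-1 * c (block N p k) * D k| <=
  eta * Q k + (2 * Kc + 4) * (eta * dr k).
  move=> kp; have [b1 [b2 b3]] := blk k kp.
  have /andP[k0 kt] := pt_itv pp (ltnW kp).
  have /andP[k10 k1t] := pt_itv pp kp.
  have klt := pt_lt pp kp.
  have kmesh := le_trans (mesh_ge kp) pmesh.
  have bN0 : 0 <= (block N p k)%:R / N%:R :> R by rewrite divr_ge0// ltW.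
  have N2 : 2 / N%:R = N%:R^-1 + N%:R^-1 :> R by rewrite -mulr2n mulr_natl.
  have -> : I (pt p k.+1) - I (pt p k) =
    G (U (pt p k.+1)) - G (U (pt p k)) - s0 * (r (pt p k.+1) - r (pt p k)).
    by rewrite /I; ring.
  apply: (@avg_expansion G g g1) => //.
  - exact: ltW.
  - by apply: g1K; lra.
  - by move=> x y ? ? ?; apply: rnd; lra.
  - move=> x y ? ?; have [] := osc x y _ _ _ => //; try lra.
    by rewrite N2 ler_norml; lra.
  - move=> x ?; have [] := osc x ((block N p k)%:R / N%:R) _ _ _ => //; try lra.
    by rewrite N2 ler_norml; lra.
  - by move=> ?; apply: grow; lra.
have IE : G (b t + r t) - G (b 0 + r 0) - s0 * (r t - r 0) =
    \sum_(k < size p) (I (pt p k.+1) - I (pt p k)).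
  by rewrite (sum_increments _ pp) /I /U; ring.
have blocks : \sum_(k < size p) 2^-1 * c (block N p k) * D k =
    \sum_(j < N.+1) (2^-1 * c j * \sum_(k < size p | block N p k == j) D k).
  under [RHS]eq_bigr do rewrite mulr_sumr big_mkcond.
  rewrite exchange_big/=; apply: eq_bigr => k _.
  have [_ [_ b3]] := blk k (ltn_ord k).
  rewrite (bigD1 (Ordinal b3))//= eqxx big1 ?addr0// => j.
  by rewrite -val_eqE/= eq_sym => /negbTE ->.
have -> : \sum_(k < size p) S k - (G (b t + r t) - G (b 0 + r 0) - s0 * (r t - r 0)) =
   \sum_(k < size p) (S k - (I (pt p k.+1) - I (pt p k)) + 2^-1 * c (block N p k) * D k)
   - \sum_(j < N.+1) (2^-1 * c j * \sum_(k < size p | block N p k == j) D k).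
  by rewrite -blocks IE [in RHS]big_split/= addrK [RHS]sumrB.
rewrite (le_trans (ler_normB _ _))// addrC -addrA lerD//.
  rewrite (le_trans (ler_norm_sum _ _ _))// mulr_sumr; apply: ler_sum => j _.
  rewrite normrM ler_wpM2r// normrM ger0_norm ?invr_ge0//.
  have : `|c j| <= Kc.
    apply: g1K; apply/andP; split; first by rewrite divr_ge0// ltW.
    by rewrite ler_pdivrMr// mul1r ler_nat -ltnS.
  have := normr_ge0 (c j); lra.
rewrite (le_trans (ler_norm_sum _ _ _))//.
rewrite -(sum_increments r pp) mulr_sumr !mulr_sumr -big_split/=.
by apply: ler_sum => k _; exact: main.
Qed.

(** For [kap] the variance of the standard normal law this is a centred square. *)
Definition comp_sq (kap : R) b (a c : R) := (b c - b a) ^+ 2 - kap * (c - a).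

Definition node (p : seq R) (k : nat) (th : R) := pt p k + th * (pt p k.+1 - pt p k).

(** For a fixed relative position [th] in the cells both sums run over disjoint
  intervals, so that orthogonality applies to each of them. *)
Definition block_dev (kap : R) b (p : seq R) (P : pred nat) (th : R) :=
  `|\sum_(k < size p | P k) comp_sq kap b (node p k th) (pt p k.+1)| +
  `|\sum_(k < size p | P k) comp_sq kap b (pt p k) (node p k th)|.

Lemma node_continuous p k : continuous (node p k).
Proof. by apply: (continuous_affine_comp (f := id)) => x; exact: cvg_id. Qed.

Lemma comp_sq_continuous kap b (f h : R -> R) : continuous b -> continuous f ->
  continuous h -> continuous (fun x => comp_sq kap b (f x) (h x)).
Proof.
move=> cb cf ch; apply: continuous_sub.
  by apply: continuous_sqr; apply: continuous_sub; exact: continuous_compose.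
by apply: continuous_mul; [exact: continuous_const|exact: continuous_sub].
Qed.

Lemma block_dev_continuous kap b p (P : pred nat) : continuous b ->
  continuous (block_dev kap b p P).
Proof.
move=> cb; apply: continuous_add; apply: continuous_norm;
  [apply: (@continuous_sumn _ _ P (fun k th => comp_sq kap b (node p k th) (pt p k.+1)))
  |apply: (@continuous_sumn _ _ P (fun k th => comp_sq kap b (pt p k) (node p k th)))] => k;
  apply: comp_sq_continuous => //; try exact: node_continuous; exact: continuous_const.
Qed.

(** Each averaged [sqdiff] is a difference of two averaged centred squares: the
  two compensators [kap (1 - th) d] and [kap th d] have the same average. *)
Lemma sum_avg_sqdiff_le kap b p (P : pred nat) : continuous b ->
  `|\sum_(k < size p | P k) avg (fun s => sqdiff b (pt p k) s (pt p k.+1))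
      (pt p k) (pt p k.+1)| <= \int[mu]_(th in `[0, 1]) block_dev kap b p P th.
Proof.
move=> cb.
pose h k th := comp_sq kap b (node p k th) (pt p k.+1) - comp_sq kap b (pt p k) (node p k th).
have ch k : continuous (h k).
  by apply: continuous_sub; apply: comp_sq_continuous => //;
    try exact: node_continuous; exact: continuous_const.
have hE k : avg (fun s => sqdiff b (pt p k) s (pt p k.+1)) (pt p k) (pt p k.+1) =
    \int[mu]_(th in `[0, 1]) h k th.
  pose e (th : R) := (1 - th) * (kap * (pt p k.+1 - pt p k)) -
    th * (kap * (pt p k.+1 - pt p k)).
  have cid : continuous (fun th : R => th) by move=> x; exact: cvg_id.
  have cc := @continuous_const R.
  have ce : continuous e.
    by apply: continuous_sub; apply: continuous_mul => //; exact: continuous_sub.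
  transitivity (\int[mu]_(th in `[0, 1]) (h k th + e th)); last first.
    by rewrite unit_RintegralD// unit_Rintegral_symmetric addr0.
  by apply: eq_Rintegral => th _; rewrite /h /e /comp_sq /sqdiff /node; ring.
under eq_bigr do rewrite hE.
rewrite -unit_Rintegral_sum//; apply: unit_norm_le_Rintegral.
- exact: continuous_sumn.
- exact: block_dev_continuous.
by move=> th _; rewrite /block_dev /h sumrB ler_normB.
Qed.

End pathwise_error.

(** * Moments of the normal law *)

Section gaussian_moments.
Context {R : realType}.
Local Notation mu := (@lebesgue_measure R).
Local Open Scope ereal_scope.

Lemma ge0_integral_normal_prob (s : R) (f : R -> \bar R) :
  measurable_fun setT f -> (forall x, 0 <= f x) ->
  \int[normal_prob 0 s]_x f x = \int[mu]_x (f x * (normal_pdf 0 s x)%:E).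
Proof.
move=> mf f0; have dom := @normal_prob_dominates R 0 s.
rewrite -(Radon_Nikodym_SigmaFinite.change_of_variables dom)//.
have mpdf : measurable_fun setT (EFin \o @normal_pdf R 0 s).
  by apply/measurable_EFinP; exact: measurable_normal_pdf.
have mRN := measurable_int _ (Radon_Nikodym_SigmaFinite.f_integrable dom).
apply: ge0_ae_eq_integral => //.
- exact: emeasurable_funM.
- exact: emeasurable_funM.
- by move=> x _; rewrite mule_ge0// Radon_Nikodym_SigmaFinite.f_ge0.
- by move=> x _; rewrite mule_ge0// lee_fin normal_pdf_ge0.
apply: ae_eqe_mul2l; apply: integral_ae_eq => //.
  exact: Radon_Nikodym_SigmaFinite.f_integrable.
by move=> E _ mE; rewrite -Radon_Nikodym_SigmaFinite.f_integral.
Qed.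

Lemma normal_pdf_scale (s x : R) : (0 < s)%R ->
  (normal_pdf 0 s (s * x) * s = normal_pdf 0 1 x)%R.
Proof.
move=> s0; rewrite !normal_pdfE ?oner_eq0 ?gt_eqF// /normal_peak /normal_fun.
have -> : (s ^+ 2 * pi *+ 2 = s ^+ 2 * (1 ^+ 2 * pi *+ 2))%R.
  by rewrite expr1n mul1r mulrnAr.
rewrite sqrtrM ?sqr_ge0// sqrtr_sqr gtr0_norm// !subr0.
have -> : (- (s * x) ^+ 2 / (s ^+ 2 *+ 2) = - x ^+ 2 / (1 ^+ 2 *+ 2))%R.
  by rewrite -(mulr_natl (s ^+ 2) 2) -(mulr_natl (1 ^+ 2) 2); field; rewrite gt_eqF.
rewrite invfM mulrC !mulrA mulfV ?gt_eqF// mul1r//.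
Qed.

(** Scaling reduces the even moments to those of the standard normal law. *)
Lemma normal_even_moment (s : R) (n : nat) : (0 < s)%R ->
  \int[normal_prob 0 s]_x (x ^+ n.*2)%:E =
  (s ^+ n.*2)%:E * \int[normal_prob 0 1]_x (x ^+ n.*2)%:E.
Proof.
move=> s0.
have mX : measurable_fun setT (fun x : R => (x ^+ n.*2)%:E).
  by apply/measurable_EFinP; exact: exprn_measurable.
have X0 (x : R) : 0 <= (x ^+ n.*2)%:E.
  by rewrite lee_fin -mul2n exprM exprn_ge0// sqr_ge0.
rewrite !ge0_integral_normal_prob//.
have dF (x : R) : is_derive x 1%R (fun y : R => s * y)%R s.
  by have := is_derive1Zl s (is_derive_id x 1%R); rewrite mulr1.
have F'E : (fun y : R => s * y)%R^`()%classic = cst s.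
  by apply/funext => x; rewrite derive1E; have [] := dF x.
have E := @increasing_ge0_integration_by_substitutionT R (fun y => s * y)%R
  (fun x => x ^+ n.*2 * normal_pdf 0 s x)%R.
under eq_integral do rewrite -EFinM.
rewrite E.
- rewrite -ge0_integralZl_EFin//.
  + apply: eq_integral => x _; rewrite F'E /= -!EFinM; congr EFin.
    by rewrite !fctE/= -mulrA normal_pdf_scale// exprMn mulrA.
  + by move=> x _; rewrite mule_ge0// lee_fin normal_pdf_ge0.
  + by apply: emeasurable_funM => //; apply/measurable_EFinP; exact: measurable_normal_pdf.
  + by rewrite exprn_ge0// ltW.
- by move=> x y xy; rewrite ltr_pM2l.
- by rewrite F'E => ?; exact: cvg_cst.
- by rewrite F'E; exact: is_cvg_cst.
- by rewrite F'E; exact: is_cvg_cst.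
- by move=> x; have [] := dF x.
- by under eq_cvg do rewrite mulrC; apply/gt0_cvgMlNy => //; exact: cvg_id.
- by under eq_cvg do rewrite mulrC; apply/gt0_cvgMly => //; exact: cvg_id.
- apply: continuous_mul; first exact: exprn_continuous.
  by apply: continuous_normal_pdf; rewrite gt_eqF.
- by move=> x; rewrite mulr_ge0 ?normal_pdf_ge0// -lee_fin.
Qed.

Lemma expR_quarter_sqr (x : R) : (x ^+ 2 <= 64 * expR (x ^+ 2 / 4))%R /\
  (x ^+ 4 <= 64 * expR (x ^+ 2 / 4))%R.
Proof.
have y0 : (0 <= x ^+ 2 / 8)%R by rewrite divr_ge0 ?sqr_ge0.
have h1 := expR_ge1Dx (x ^+ 2 / 8).
have -> : expR (x ^+ 2 / 4) = (expR (x ^+ 2 / 8) ^+ 2)%R.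
  by rewrite -expRM_natl; congr expR; field.
have h2 : (x ^+ 2 / 8 <= expR (x ^+ 2 / 8))%R by lra.
have e1 : (1 <= expR (x ^+ 2 / 8))%R by lra.
split; first by rewrite expr2; nra.
have -> : (x ^+ 4 = 64 * (x ^+ 2 / 8) ^+ 2)%R by field.
by rewrite ler_pM2l// ler_pXn2r// nnegrE expR_ge0.
Qed.

(** Comparison with the density of variance [2]: a factor [exp (- x^2 / 4)] is
  left to absorb the power of [x]. *)
Lemma normal_moment_finite (n : nat) : (1 <= n <= 2)%N ->
  \int[@normal_prob R 0 1]_x (x ^+ n.*2)%:E < +oo.
Proof.
move=> n12.
have mX : measurable_fun setT (fun x : R => (x ^+ n.*2)%:E).
  by apply/measurable_EFinP; exact: exprn_measurable.
have X0 (x : R) : 0 <= (x ^+ n.*2)%:E.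
  by rewrite lee_fin -mul2n exprM exprn_ge0// sqr_ge0.
rewrite ge0_integral_normal_prob//.
pose t : R := Num.sqrt 2; have t2 : (t ^+ 2 = 2)%R by rewrite sqr_sqrtr.
have t0 : (0 < t)%R by rewrite sqrtr_gt0.
pose c := (64 * (normal_peak 1 / normal_peak t))%R.
have c0 : (0 <= c)%R by rewrite mulr_ge0// divr_ge0 ?normal_peak_ge0.
apply: (@le_lt_trans _ _ (\int[mu]_x (c%:E * (normal_pdf 0 t x)%:E))).
  apply: ge0_le_integral => //.
  - by move=> x _; rewrite mule_ge0// lee_fin normal_pdf_ge0.
  - by apply: emeasurable_funM => //; apply/measurable_EFinP; exact: measurable_normal_pdf.
  - apply: emeasurable_funM => //; apply/measurable_EFinP; exact: measurable_normal_pdf.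
  move=> x _; rewrite -!EFinM lee_fin.
  have xle : (x ^+ n.*2 <= 64 * expR (x ^+ 2 / 4))%R.
    by have [] := expR_quarter_sqr x; case: n n12 {mX X0} => [|[|[|]]].
  apply: (le_trans (ler_wpM2r (normal_pdf_ge0 _ _ _) xle)).
  rewrite !normal_pdfE ?oner_eq0 ?gt_eqF// /normal_fun !subr0 t2.
  rewrite /c -!mulrA ler_pM2l// mulrCA ler_pM2l ?normal_peak_gt0 ?oner_eq0//.
  rewrite mulKf ?gt_eqF ?normal_peak_gt0 ?gt_eqF//.
  by rewrite -expRD ler_expR le_eqVlt; apply/orP; left; apply/eqP; field.
rewrite ge0_integralZl_EFin//.
- by rewrite integral_normal_pdf mule1 ltry.
- by move=> x _; rewrite lee_fin normal_pdf_ge0.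
- by apply/measurable_EFinP; exact: measurable_normal_pdf.
Qed.

(** The variance is left uncomputed: the compensators cancel in the averages
  whatever its value. *)
Definition nvar : R := fine (\int[@normal_prob R 0 1]_x (x ^+ 1.*2)%:E).
Definition nfourth : R := fine (\int[@normal_prob R 0 1]_x (x ^+ 2.*2)%:E).

Lemma normal_second_moment (s : R) : (0 < s)%R ->
  \int[normal_prob 0 s]_x (x ^+ 2)%:E = (nvar * s ^+ 2)%:E.
Proof.
move=> s0; transitivity ((s ^+ 2)%:E * nvar%:E); last by rewrite -EFinM mulrC.
rewrite (@normal_even_moment s 1)// /nvar fineK//.
rewrite ge0_fin_numE ?normal_moment_finite//.
by apply: integral_ge0 => x _; rewrite lee_fin sqr_ge0.
Qed.

Lemma normal_fourth_moment (s : R) : (0 < s)%R ->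
  \int[normal_prob 0 s]_x (x ^+ 4)%:E = (nfourth * s ^+ 4)%:E.
Proof.
move=> s0; transitivity ((s ^+ 4)%:E * nfourth%:E); last by rewrite -EFinM mulrC.
rewrite (@normal_even_moment s 2)// /nfourth fineK//.
rewrite ge0_fin_numE ?normal_moment_finite//.
by apply: integral_ge0 => x _; rewrite lee_fin (exprM _ 2 2) sqr_ge0.
Qed.

Lemma nvar_ge0 : (0 <= nvar)%R.
Proof. by rewrite fine_ge0// integral_ge0// => x _; rewrite lee_fin sqr_ge0. Qed.

Lemma nfourth_ge0 : (0 <= nfourth)%R.
Proof.
by rewrite fine_ge0// integral_ge0// => x _; rewrite lee_fin (exprM _ 2 2) sqr_ge0.
Qed.

(** The centred square has mean [0], so the cross term with [y] vanishes; its
  variance is at most the fourth moment. *)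
Lemma normal_shifted_square (s y : R) : (0 < s)%R ->
  \int[normal_prob 0 s]_x ((y + (x ^+ 2 - nvar * s ^+ 2)) ^+ 2)%:E
  <= (y ^+ 2 + nfourth * s ^+ 4)%:E.
Proof.
move=> s0; set N := normal_prob 0 s.
pose a : R := (y - nvar * s ^+ 2)%R.
have mpow n : measurable_fun setT (fun x : R => x ^+ n)%R by exact: exprn_measurable.
have i4 : N.-integrable setT (EFin \o (fun x : R => x ^+ 4)%R).
  apply/integrableP; split; first exact/measurable_EFinP.
  under eq_integral => x _ do
    rewrite /= ger0_norm ?(exprM _ 2 2) ?sqr_ge0// -(exprM x 2 2).
  by rewrite normal_fourth_moment// ltry.
have i2 : N.-integrable setT (EFin \o (fun x : R => x ^+ 2)%R).
  apply/integrableP; split; first exact/measurable_EFinP.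
  under eq_integral => x _ do rewrite /= ger0_norm ?sqr_ge0//.
  by rewrite normal_second_moment// ltry.
have ic (c : R) : N.-integrable setT (EFin \o (fun _ : R => c)).
  exact: finite_measure_integrable_cst.
have i2a : N.-integrable setT (EFin \o (fun x : R => (2 * a) * x ^+ 2)%R).
  exact: (integrableZl measurableT (2 * a)%R i2).
have polyE (x : R) : ((y + (x ^+ 2 - nvar * s ^+ 2)) ^+ 2 =
  x ^+ 4 + (2 * a * x ^+ 2 + a ^+ 2))%R by rewrite /a; ring.
under eq_integral do rewrite polyE.
have i2c : N.-integrable setT (EFin \o (fun x : R => (2 * a) * x ^+ 2 + a ^+ 2)%R).
  exact: (integrableD measurableT i2a (ic _)).
rewrite (integralD_EFin measurableT i4 i2c) (integralD_EFin measurableT i2a (ic _)).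
rewrite normal_fourth_moment// (integralZl measurableT i2) normal_second_moment//.
rewrite integral_cst//= probability_setT mule1 -EFinM -!EFinD lee_fin.
have -> : (nfourth * s ^+ 4 + (2 * a * (nvar * s ^+ 2) + a ^+ 2) =
   y ^+ 2 + nfourth * s ^+ 4 - (nvar * s ^+ 2) ^+ 2)%R by rewrite /a; ring.
by rewrite gerBl sqr_ge0.
Qed.

End gaussian_moments.

(** * Orthogonality of compensated squares *)

Section independence.
Context {d : measure_display} {T : measurableType d} {R : realType}.
Variable P : probability T R.
Local Open Scope ereal_scope.

(** By uniqueness of product measures the pair [(Y, D)] has the product law;
  Tonelli's theorem then integrates [D] first. *)
Lemma ge0_integral_independent (Fs : set (set T)) (Y D : T -> R) (s : R)
    (h : R * measurableTypeR R -> \bar R) :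
  Fs `<=` measurable ->
  (forall U : set R, measurable U -> Fs (Y @^-1` U)) ->
  measurable_fun setT D ->
  (forall A (U : set R), Fs A -> measurable U ->
    P (A `&` D @^-1` U) = P A * P (D @^-1` U)) ->
  (forall U : set R, measurable U -> P (D @^-1` U) = normal_prob 0 s U) ->
  measurable_fun setT h -> (forall z, 0 <= h z) ->
  \int[P]_w h (Y w, D w) =
  \int[P]_w \int[normal_prob 0 s]_x h (Y w, x).
Proof.
move=> FsM FY mD ind lawD mh h0.
have mY : measurable_fun setT Y by move=> _ U mU; rewrite setTI; exact/FsM/FY.
pose Y' : {mfun T >-> R} := HB.pack Y (isMeasurableFun.Build _ _ _ _ _ mY).
have mYD : measurable_fun setT
    (fun w => (Y w, D w) : R * measurableTypeR R).
  have mD' : measurable_fun setT (D : T -> measurableTypeR R) := mD.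
  exact: measurable_fun_pair.
pose YD : {mfun T >-> (R * measurableTypeR R)%type} := HB.pack (fun w => (Y w, D w))
  (isMeasurableFun.Build _ _ _ _ _ mYD).
have prodE := @product_measure_unique _ _ _ _ R (distribution P Y')
  (@normal_prob R 0 s) (distribution P YD).
have {}prodE : forall X, measurable X ->
    (distribution P Y' \x @normal_prob R 0 s) X = distribution P YD X.
  apply: prodE => A B mA mB.
  rewrite /distribution/= /pushforward -lawD// -(ind _ _ (FY _ mA) mB).
  by congr (P _).
have -> : \int[P]_w h (Y w, D w) = \int[distribution P YD]_z h z.
  by rewrite ge0_integral_pushforward.
transitivity (\int[distribution P Y' \x @normal_prob R 0 s]_z h z).
  by apply: eq_measure_integral => A mA _; exact/esym/prodE.
rewrite fubini_tonelli1// ge0_integral_pushforward//.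
  exact: measurable_fun_fubini_tonelli_F.
by move=> y _; apply: integral_ge0.
Qed.

End independence.

Section brownian_squares.
Context {d : measure_display} {T : measurableType d} {R : realType}.
Variables (P : probability T R) (F : R -> set (set T)) (B : R -> {RV P >-> R}).
Hypotheses (hF : usual_filtration P F) (hB : brownian_motion F B).
Local Open Scope ereal_scope.

Definition adapted (s : R) (f : T -> R) :=
  forall U : set R, measurable U -> F s (f @^-1` U).

Lemma adaptedP (s : R) (f : T -> R) : (0 <= s <= 1)%R ->
  adapted s f <-> measurable_fun (T := g_sigma_algebraType (F s)) setT f.
Proof.
move=> s01; have sF := filtration_sigma_algebra hF s01.
split=> [fs _ U mU|mf U mU].
  rewrite setTI; apply: sub_sigma_algebra; exact: fs.
have := mf measurableT U mU; rewrite setTI /measurable/=.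
by rewrite -[X in X -> _]/(<<s F s >> (f @^-1` U)) sigma_algebra_id.
Qed.

Lemma adapted_brownian (a s : R) : (0 <= a)%R -> (a <= s)%R -> (s <= 1)%R ->
  adapted s (B a).
Proof.
move=> a0 as_ s1 U mU; apply: (filtration_nondecreasing hF a0 as_ s1).
by apply: brownian_adapted hB _ _ _ mU; rewrite a0 (le_trans as_).
Qed.

Lemma adapted_comp_sq kap (a c s : R) : (0 <= a)%R -> (a <= c)%R -> (c <= s)%R ->
  (s <= 1)%R -> adapted s (fun w => comp_sq kap (fun t => B t w) a c).
Proof.
move=> a0 ac cs s1; have s01 : (0 <= s <= 1)%R by rewrite s1 (le_trans a0 (le_trans ac cs)).
have c0 := le_trans a0 ac.
apply/(adaptedP _ s01); apply: measurable_funB => //.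
apply: measurable_funX; apply: measurable_funB; apply/(adaptedP _ s01).
  exact: adapted_brownian.
by apply: adapted_brownian => //; exact: le_trans cs.
Qed.

Lemma adaptedD (s : R) (f g : T -> R) : (0 <= s <= 1)%R -> adapted s f ->
  adapted s g -> adapted s (fun w => f w + g w)%R.
Proof.
by move=> s01 /(adaptedP _ s01) mf /(adaptedP _ s01) mg;
  apply/(adaptedP _ s01); exact: measurable_funD.
Qed.

Lemma adapted_cst (s r : R) : (0 <= s <= 1)%R -> adapted s (fun=> r).
Proof. by move=> s01; apply/(adaptedP _ s01); exact: measurable_cst. Qed.

Lemma adapted_sum (s : R) n (J : pred nat) (f : nat -> T -> R) :
  (0 <= s <= 1)%R -> (forall k, (k < n)%N -> adapted s (f k)) ->
  adapted s (fun w => \sum_(k < n | J k) f k w)%R.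
Proof.
move=> s01; elim: n => [|n IH] fs.
  rewrite (_ : (fun _ => _) = cst 0%R); first exact: adapted_cst.
  by apply/funext => w; rewrite big_ord0.
rewrite (_ : (fun _ => _) = (fun w => \sum_(k < n | J k) f k w +
    (if J n then f n w else 0))%R).
  apply: adaptedD => //; first by apply: IH => k kn; apply: fs; rewrite ltnS ltnW.
  by case: (J n); [exact: fs|exact: adapted_cst].
by apply/funext => w; rewrite (big_ord_cond_recr _ _ (fun k => f k w)).
Qed.

Lemma increment_measurable (a c : R) : measurable_fun setT (fun w => B c w - B a w)%R.
Proof. exact: measurable_funB. Qed.

Lemma increment_second_moment (a c : R) : (0 <= a)%R -> (a <= c)%R -> (c <= 1)%R ->
  \int[P]_w ((B c w - B a w) ^+ 2)%:E = (nvar * (c - a))%:E.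
Proof.
move=> a0; rewrite le_eqVlt => /predU1P[->|ac] c1.
  rewrite subrr mulr0; under eq_integral do rewrite subrr expr0n/=.
  by rewrite integral0.
have s0 : (0 < Num.sqrt (c - a))%R by rewrite sqrtr_gt0 subr_gt0.
have mD := increment_measurable a c.
have {}mD : measurable_fun setT
  (fun w => (B c w - B a w)%R : measurableTypeR R) := mD.
pose D : {mfun T >-> measurableTypeR R} := HB.pack (fun w => B c w - B a w : measurableTypeR R)%R (isMeasurableFun.Build _ _ _ _ _ mD).
have m2 : measurable_fun setT (fun x : R => (x ^+ 2)%:E).
  by apply/measurable_EFinP; exact: exprn_measurable.
transitivity (\int[distribution P D]_x (x ^+ 2)%:E).
  by rewrite ge0_integral_pushforward// => x _; rewrite lee_fin sqr_ge0.
rewrite (@eq_measure_integral _ _ _ _ (normal_prob 0 (Num.sqrt (c - a)))).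
  by rewrite normal_second_moment// sqr_sqrtr// subr_ge0 ltW.
by move=> U mU _; exact: (brownian_gaussian_increments hB a0 ac c1 mU).
Qed.

Lemma square_add_comp_sq (Y : T -> R) (a c : R) :
  (0 <= a)%R -> (a <= c)%R -> (c <= 1)%R -> adapted a Y ->
  \int[P]_w ((Y w + comp_sq nvar (fun t => B t w) a c) ^+ 2)%:E <=
  \int[P]_w ((Y w) ^+ 2)%:E + (nfourth * (c - a) ^+ 2)%:E.
Proof.
move=> a0; rewrite le_eqVlt => /predU1P[->|ac] c1 aY.
  rewrite subrr expr0n mulr0 adde0 le_eqVlt; apply/orP; left; apply/eqP.
  by apply: eq_integral => w _; rewrite /comp_sq !subrr expr0n/= mulr0 subrr addr0.
have a1 : (a <= 1)%R by rewrite (le_trans (ltW ac)).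
have a01 : (0 <= a <= 1)%R by rewrite a0.
have s0 : (0 < Num.sqrt (c - a))%R by rewrite sqrtr_gt0 subr_gt0.
have s2 : (Num.sqrt (c - a) ^+ 2 = c - a)%R by rewrite sqr_sqrtr// subr_ge0 ltW.
have mY : measurable_fun setT Y.
  by move=> _ U mU; rewrite setTI; apply: filtration_measurable hF _ a01 _ _; exact: aY.
pose h (z : R * measurableTypeR R) := ((z.1 + (z.2 ^+ 2 - nvar * Num.sqrt (c - a) ^+ 2)) ^+ 2)%:E.
have h0 z : 0 <= h z by rewrite lee_fin sqr_ge0.
have mh : measurable_fun setT h.
  have m2 : measurable_fun setT (fun z : R * measurableTypeR R => z.2 : R) :=
    measurable_snd.
  apply/measurable_EFinP; apply: measurable_funX; apply: measurable_funD => //.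
  by apply: measurable_funB => //; exact: measurable_funX.
have := @ge0_integral_independent _ T R P (F a) Y (fun w => B c w - B a w)%R
  (Num.sqrt (c - a)) h (filtration_measurable hF a01) aY (increment_measurable a c)
  (fun A U => brownian_independent_increments hB a0 ac c1 (A := A) (U := U))
  (brownian_gaussian_increments hB a0 ac c1) mh h0.
rewrite /h /= s2 /comp_sq => ->.
apply: (@le_trans _ _ (\int[P]_w ((Y w ^+ 2)%:E + (nfourth * (c - a) ^+ 2)%:E))).
  apply: ge0_le_integral => //.
  - by move=> w _; apply: integral_ge0 => x _; rewrite lee_fin sqr_ge0.
  - have := @measurable_fun_fubini_tonelli_F _ _ _ _ R (@normal_prob R 0 (Num.sqrt (c - a)))
      h mh h0.
    rewrite /fubini_F /h /= s2 => mF.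
    exact: (measurableT_comp mF mY).
  - by apply: emeasurable_funD => //; apply/measurable_EFinP; exact: measurable_funX.
  move=> w _; have := normal_shifted_square (Y w) s0; rewrite s2.
  by rewrite (exprM _ 2 2) s2.
rewrite ge0_integralD//.
- by rewrite integral_cst//= probability_setT mule1.
- by move=> w _; rewrite lee_fin sqr_ge0.
- by apply/measurable_EFinP; exact: measurable_funX.
- by move=> w _; rewrite lee_fin mulr_ge0 ?nfourth_ge0 ?sqr_ge0.
Qed.

(** Centred squares over successive disjoint intervals are orthogonal. *)
Lemma sum_comp_sq_second_moment (n : nat) (J : pred nat) (a c : nat -> R) :
  (forall k, (k < n)%N -> [/\ 0 <= a k, a k <= c k & c k <= 1]%R) ->
  (forall i k, (i < k)%N -> (k < n)%N -> (c i <= a k)%R) ->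
  \int[P]_w ((\sum_(k < n | J k) comp_sq nvar (fun t => B t w) (a k) (c k)) ^+ 2)%:E
  <= (nfourth * \sum_(k < n) (c k - a k) ^+ 2)%:E.
Proof.
elim: n => [|n IH] ac01 ca.
  under eq_integral do rewrite big_ord0 expr0n/=.
  by rewrite integral0 big_ord0 mulr0.
have {}IH : \int[P]_w ((\sum_(k < n | J k) comp_sq nvar (fun t => B t w) (a k) (c k)) ^+ 2)%:E
  <= (nfourth * \sum_(k < n) (c k - a k) ^+ 2)%:E.
  by apply: IH => [k kn|i k ik kn]; [apply: ac01; rewrite ltnS ltnW|apply: ca => //; rewrite ltnS ltnW].
have [an0 anc cn1] := ac01 n (ltnSn n).
have an1 := le_trans anc cn1.
rewrite [X in (_ * X)%:E]big_ord_recr/= mulrDr.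
under eq_integral => w _ do rewrite (big_ord_cond_recr _ _
  (fun k => comp_sq nvar (fun t => B t w) (a k) (c k))).
case: (J n); last first.
  under eq_integral do rewrite addr0.
  apply: (le_trans IH); rewrite lee_fin lerDl mulr_ge0 ?nfourth_ge0 ?sqr_ge0//.
rewrite EFinD; apply: le_trans (leeD2r _ IH).
apply: square_add_comp_sq => //.
apply: (@adapted_sum _ _ _ (fun k w => comp_sq nvar (fun t => B t w) (a k) (c k)))
  => [|k kn]; first by rewrite an0.
have [ak0 akc ck1] := ac01 k (ltnW kn).
by apply: adapted_comp_sq => //; exact: ca.
Qed.

End brownian_squares.

(** * Continuous processes and likely events *)

Section joint_measurability.
Context {d : measure_display} {T : measurableType d} {R : realType}.
Implicit Types V : R -> T -> R.

(** A process with continuous paths is the pointwise limit of the processes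
  frozen on the cells of length [1 / n.+1]. *)
Lemma measurable_continuous_process V :
  (forall w, continuous (V ^~ w)) -> (forall s, measurable_fun setT (V s)) ->
  measurable_fun setT (fun z : measurableTypeR R * T => V z.1 z.2).
Proof.
move=> cV mV.
pose grid n (s : R) : R := (Num.floor (n.+1%:R * s))%:~R / n.+1%:R.
have gridP n s : grid n s <= s /\ s < grid n s + n.+1%:R^-1.
  have n0 : 0 < n.+1%:R :> R by [].
  have /andP[h1 h2] := Num.Theory.floor_itv (n.+1%:R * s); split.
    by rewrite /grid ler_pdivrMr// [s * _]mulrC.
  rewrite /grid -[X in _ + X]mul1r -mulrDl ltr_pdivlMr// [s * _]mulrC.
  by move: h2; rewrite intrD.
apply: (@measurable_fun_cvg _ _ _ setT (fun n (z : measurableTypeR R * T) => V (grid n z.1) z.2)).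
  move=> n _ U mU; rewrite setTI.
  pose cell (k : int) : set (measurableTypeR R) := [set s | Num.floor (n.+1%:R * s) = k].
  have -> : (fun z : measurableTypeR R * T => V (grid n z.1) z.2) @^-1` U =
      \bigcup_(k : int) (cell k `*` (V (k%:~R / n.+1%:R) @^-1` U)).
    apply/seteqP; split=> [[s w] /= h|[s w] /= [k _ [/= <-]]//].
    by exists (Num.floor (n.+1%:R * s)).
  apply: countable_bigcupT_measurable; first exact: countableP.
  move=> k; apply: measurableX; last by rewrite -[X in measurable X]setTI; exact: mV.
  have -> : cell k = `[(k%:~R / n.+1%:R : R), ((k + 1)%:~R / n.+1%:R : R)[%classic.
    have n0 : 0 < n.+1%:R :> R by [].
    apply/seteqP; split=> s /=.
      move=> <-; rewrite in_itv/= ler_pdivrMr// ltr_pdivlMr// mulrC.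
      exact: Num.Theory.floor_itv.
    rewrite in_itv/= ler_pdivrMr// ltr_pdivlMr// mulrC => h.
    exact: Num.Theory.floor_def.
  exact: measurable_itv.
move=> [s w] _ /=; apply: (cvg_comp (fun n => grid n s) (V ^~ w)); last exact: cV.
apply/cvgrPdist_lt => e e0; near=> n.
have [h1 h2] := gridP n s; rewrite ger0_norm ?subr_ge0// ltrBlDl.
apply: (lt_trans h2); rewrite ltrD2l.
by near: n; exact: near_infty_natSinv_lt (PosNum e0).
Unshelve. all: by end_near. Qed.

End joint_measurability.

Section uniform_continuity.
Context {R : realType}.

Lemma uniform_continuity_segment (f : R -> R) (eta : R) : continuous f -> 0 < eta ->
  exists n : nat, forall x y, 0 <= x <= 1 -> `|y - x| <= n.+1%:R^-1 ->
    `|f y - f x| <= eta.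
Proof.
move=> cf eta0.
have := @segment_compact R 0 1 => /compact_near_coveringP/(_ nat \oo
  (fun n x => forall y, `|y - x| <= n.+1%:R^-1 -> `|f y - f x| <= eta)).
have eta2 : 0 < eta / 2 by rewrite divr_gt0.
move=> /(_ _)[x _|n _ nP]; last first.
  by exists n => x y x01; apply: (nP n (leqnn n)); rewrite /= in_itv.
have [e e0 he] := continuous_near_point x cf eta2.
have e2 : 0 < e / 2 by rewrite divr_gt0.
near=> x' n => y /= yx'.
have xx' : `|x' - x| < e / 2.
  by rewrite distrC; near: x'; apply: (@cvgr_dist_lt _ _ R _ _ id x).
have ne : n.+1%:R^-1 < e / 2 :> R by near: n; exact: near_infty_natSinv_lt (PosNum e2).
have h1 : `|f x' - f x| < eta / 2 by apply: he; lra.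
have h2 : `|f y - f x| < eta / 2.
  by apply: he; move: yx' xx' ne; rewrite ler_norml !ltr_norml;
    move: (n.+1%:R^-1 : R) => u; lra.
by move: h1 h2; rewrite ler_norml !ltr_norml; lra.
Unshelve. all: by end_near. Qed.

End uniform_continuity.

Section likely_events.
Context {d : measure_display} {T : measurableType d} {R : realType}.
Variable P : probability T R.
Implicit Types V : R -> T -> R.

(** Estimates that hold off a small measurable event; keeping only the event
  spares the measurability of the estimates themselves. *)
Definition likely (h : R) (Q : T -> Prop) :=
  exists A, [/\ measurable A, (P A <= h%:E)%E & forall w, ~ A w -> Q w].

Lemma likelyI h1 h2 Q1 Q2 : likely h1 Q1 -> likely h2 Q2 ->
  likely (h1 + h2) (fun w => Q1 w /\ Q2 w).
Proof.
move=> [A1 [mA1 PA1 Q1A]] [A2 [mA2 PA2 Q2A]]; exists (A1 `|` A2); split.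
- exact: measurableU.
- rewrite EFinD; apply: le_trans (leeD PA1 PA2); exact: measureU2.
- by move=> w A12; split; [apply: Q1A|apply: Q2A] => h; apply: A12; [left|right].
Qed.

(** Continuity of the measure from above along the complements. *)
Lemma likely_of_exhaustion (A : nat -> set T) (h : R) : 0 < h ->
  (forall n, measurable (A n)) -> (forall m n, (m <= n)%N -> A m `<=` A n) ->
  (forall w, exists n, A n w) -> exists n, likely h (A n).
Proof.
move=> h0 mA ndA exA.
have : P \o (fun n => ~` A n) @ \oo --> P (\bigcap_n ~` A n).
  apply: nonincreasing_cvg_mu.
  - by rewrite (le_lt_trans (probability_le1 _ _)) ?ltry//; exact: measurableC.
  - by move=> n; exact: measurableC.
  - by apply: bigcap_measurableType => n _; exact: measurableC.
  - by move=> m n mn; apply/subsetPset; apply: subsetC; exact: ndA.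
rewrite (_ : \bigcap_n ~` A n = set0); last first.
  by apply/seteqP; split=> // w Aw; have [n /(Aw n I)] := exA w.
rewrite measure0 => /fine_cvgP[_ /cvgrPdist_lt/(_ h h0)[n _ nP]].
exists n, (~` A n); split; first exact: measurableC.
  have := nP n (leqnn n); rewrite sub0r normrN /= ger0_norm ?fine_ge0//.
  move=> /ltW; rewrite -lee_fin fineK// fin_num_measure//; exact: measurableC.
by move=> w /contrapT.
Qed.

Lemma likely_forall (I : countType) (C : nat -> I -> set T) (h : R) : 0 < h ->
  (forall n i, measurable (C n i)) ->
  (forall m n i, (m <= n)%N -> C m i `<=` C n i) ->
  (forall w, exists n, forall i, C n i w) ->
  exists n, likely h (fun w => forall i, C n i w).
Proof.
move=> h0 mC ndC exC.
apply: (@likely_of_exhaustion (fun n => [set w | forall i, C n i w])) => //.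
- move=> n; have -> : [set w | forall i, C n i w] = ~` \bigcup_i ~` C n i.
    rewrite setC_bigcup; apply/seteqP; split=> w /= Cw i; last by have := Cw i Logic.I; rewrite setCK.
    by move=> _; rewrite setCK.
  apply: measurableC; apply: countable_bigcupT_measurable; first exact: countableP.
  by move=> i; exact: measurableC.
- by move=> m n mn w /= Cm i; exact: ndC (Cm i).
Qed.

Lemma rat_approx (f : R -> R) (x e : R) : continuous f -> 0 <= x <= 1 -> 0 < e ->
  exists2 p : rat, 0 < (ratr p : R) < 1 & `|ratr p - x| < e /\ `|f (ratr p) - f x| < e.
Proof.
move=> cf /andP[x0 x1] e0; have [d0 d00 hd] := continuous_near_point x cf e0.
pose a := Num.min e d0; have a0 : 0 < a by rewrite lt_min e0.
have lt_ab : Num.max 0 (x - a) < Num.min 1 (x + a).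
  by rewrite gt_max !lt_min; apply/andP; split; apply/andP; split; lra.
have [p] := rat_in_itvoo lt_ab; rewrite in_itv/= gt_max lt_min.
move=> /andP[/andP[p0 xp] /andP[p1 px]].
have pxa : `|ratr p - x| < a by rewrite ltr_norml; lra.
exists p; first by rewrite p0.
move: pxa; rewrite lt_min => /andP[pe pd]; split=> //; exact: hd.
Qed.

(** A random modulus of continuity becomes deterministic off a small event. By
  density it suffices to compare rational times, with the slack [2 / n.+1]. *)
Lemma likely_modulus V (eta h : R) : (forall w, continuous (V ^~ w)) ->
  (forall s, measurable_fun setT (V s)) -> 0 < eta -> 0 < h ->
  exists n : nat, likely h (fun w => forall x y, 0 <= x <= 1 -> 0 <= y <= 1 ->
    `|x - y| <= n.+1%:R^-1 -> `|V x w - V y w| <= eta).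
Proof.
move=> cV mV eta0 h0.
pose close n (i : rat * rat) := [&& 0 < (ratr i.1 : R) < 1, 0 < (ratr i.2 : R) < 1 &
  `|ratr i.1 - ratr i.2| < (2 / n.+1%:R : R)].
pose C n i := if close n i then [set w | `|V (ratr i.1) w - V (ratr i.2) w| <= eta] else setT.
have [|||n likn] := @likely_forall (rat * rat)%type C h h0.
- move=> n i; rewrite /C; case: ifP => // _; rewrite -[X in measurable X]setTI.
  have -> : [set w | `|V (ratr i.1) w - V (ratr i.2) w| <= eta] =
     (fun w => `|V (ratr i.1) w - V (ratr i.2) w|) @^-1` `]-oo, eta].
    by apply/seteqP; split=> w /=; rewrite in_itv.
  by apply: measurableT_comp => //; exact: measurable_funB.
- move=> m n i mn w; rewrite /C /close; case: ifP => [_|ncm _].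
    by case: ifP.
  case: ifP => // /and3P[i1 i2 i3]; move: ncm; rewrite i1 i2/= (lt_le_trans i3)//.
  by rewrite ler_pM2l// lef_pV2 ?posrE// ler_nat.
- move=> w; have [n hn] := uniform_continuity_segment (cV w) eta0.
  exists n.+1.*2 => i; rewrite /C; case: ifP => //= /and3P[i1 /andP[i20 i21] i3].
  apply: hn; first by rewrite (ltW i20) ltW.
  apply/ltW; apply: (lt_le_trans i3).
  rewrite ler_pdivrMr// ler_pdivlMl// -natrM ler_nat; lia.
exists n; case: likn => A [mA PA Aw]; exists A; split => // w nAw x y x01 y01 xy.
apply/ler_addgt0Pr => e e0.
pose r := Num.min (e / 2) (2^-1 * n.+1%:R^-1).
have n0 : 0 < n.+1%:R^-1 :> R by rewrite invr_gt0.
have r0 : 0 < r by rewrite lt_min divr_gt0//= mulr_gt0.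
have [p p01 [px fp]] := rat_approx (cV w) x01 r0.
have [q q01 [qy fq]] := rat_approx (cV w) y01 r0.
have [re rn] : r <= e / 2 /\ r <= 2^-1 * n.+1%:R^-1 by rewrite !ge_min !lexx orbT.
have pq : `|ratr p - ratr q| < 2 / n.+1%:R :> R.
  move: rn px qy xy; rewrite !ltr_norml ler_norml.
  by move: (n.+1%:R^-1 : R) => u; lra.
have := Aw w nAw (p, q); rewrite /C /close/= p01 q01 pq /=.
by move: fp fq; rewrite !ltr_norml !ler_norml; lra.
Qed.

Lemma likely_bounded V (h : R) : (forall w, continuous (V ^~ w)) ->
  (forall s, measurable_fun setT (V s)) -> 0 < h ->
  exists n : nat, likely h (fun w => forall x, 0 <= x <= 1 -> `|V x w| <= n%:R).
Proof.
move=> cV mV h0.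
pose C n (p : rat) := if 0 < (ratr p : R) < 1 then [set w | `|V (ratr p) w| <= n%:R] else setT.
have [|||n likn] := @likely_forall rat C h h0.
- move=> n p; rewrite /C; case: ifP => // _; rewrite -[X in measurable X]setTI.
  have -> : [set w | `|V (ratr p) w| <= n%:R] = (fun w => `|V (ratr p) w|) @^-1` `]-oo, n%:R].
    by apply/seteqP; split=> w /=; rewrite in_itv.
  exact: measurableT_comp.
- move=> m n p mn w; rewrite /C; case: ifP => // _ /= /le_trans; apply.
  by rewrite ler_nat.
- move=> w; have cN := continuous_norm (cV w).
  have [c _ cmax] := EVT_max ler01 (continuous_subspaceT cN).
  exists (Num.truncn `|V c w|).+1 => p; rewrite /C; case: ifP => //= /andP[p0 p1].
  apply: (le_trans (cmax _ _)); first by rewrite in_itv/= !ltW.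
  by apply/ltW; have /andP[] := Num.Theory.truncn_itv (normr_ge0 (V c w)).
exists n; case: likn => A [mA PA Aw]; exists A; split => // w nAw x x01.
apply/ler_addgt0Pr => e e0.
have [p p01 [px fp]] := rat_approx (cV w) x01 e0.
have := Aw w nAw p; rewrite /C p01/=.
by move: fp; rewrite !ltr_norml !ler_norml; lra.
Qed.

Lemma likely_le (f : T -> \bar R) (c e : R) : 0 < e ->
  measurable_fun setT f -> (forall w, 0 <= f w)%E -> (\int[P]_w f w <= c%:E)%E ->
  likely (c / e) (fun w => f w <= e%:E)%E.
Proof.
move=> e0 mf f0 fc.
pose A := [set w | e%:E < f w]%E.
have mA : measurable A.
  rewrite -[A]setTI; exact: emeasurable_fun_o_infty.
exists A; split => //; last by move=> w /negP; rewrite -leNgt.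
rewrite -(@lee_pmul2l _ e%:E)// -EFinM mulrCA divff ?gt_eqF// mulr1.
apply: le_trans fc.
have -> : (e%:E * P A = \int[P]_w (e%:E * (\1_A w)%:E))%E.
  rewrite ge0_integralZl_EFin//; last exact: ltW.
    by rewrite integral_indic// setIT.
  by apply/measurable_EFinP; exact: measurable_indic.
apply: ge0_le_integral => //.
- by move=> w _; rewrite -EFinM lee_fin mulr_ge0// ltW.
- apply: emeasurable_funM => //; apply/measurable_EFinP; exact: measurable_indic.
move=> w _; rewrite indicE; case: (boolP (w \in A)) => [|_]; last by rewrite mule0.
by rewrite inE mule1 => /ltW.
Qed.

End likely_events.

(** * Averaged squares of Brownian increments *)

Section unit_integral_bounds.
Context {d : measure_display} {T : measurableType d} {R : realType}.
Local Notation mu := (@lebesgue_measure R).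

Lemma measurable_sumn d' (T' : measurableType d') n (J : pred nat) (f : nat -> T' -> R) :
  (forall k, measurable_fun setT (f k)) ->
  measurable_fun setT (fun w => \sum_(k < n | J k) f k w).
Proof.
move=> mf; elim: n => [|n IH].
  rewrite (_ : (fun _ => _) = cst 0); first exact: measurable_cst.
  by apply/funext => w; rewrite big_ord0.
rewrite (_ : (fun _ => _) = (fun w => \sum_(k < n | J k) f k w +
    (if J n then f n w else 0))).
  by apply: measurable_funD => //; case: (J n); [exact: mf|exact: measurable_cst].
by apply/funext => w; rewrite (big_ord_cond_recr _ _ (fun k => f k w)).
Qed.

Lemma measurable_segment_integral (a c : R) (f : measurableTypeR R * T -> \bar R) :
  measurable_fun setT f -> (forall z, 0 <= f z)%E ->
  measurable_fun setT (fun w => \int[mu]_(th in `[a, c]) f (th, w))%E.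
Proof.
move=> mf f0.
pose D : set (measurableTypeR R * T) := `[a, c]%classic `*` setT.
have mD : measurable D by apply: measurableX => //; exact: measurable_itv.
have -> : (fun w => \int[mu]_(th in `[a, c]) f (th, w))%E =
    fubini_G mu (f \_ D).
  apply/funext => w; rewrite integral_mkcond; apply: eq_integral => th _.
  rewrite !patchE; congr (if _ then _ else _).
  by apply/idP/idP => /[!inE]; [split|case].
apply: measurable_fun_fubini_tonelli_G.
  by apply/(measurable_restrict f mD measurableT); exact: measurable_funTS.
by move=> z; rewrite patchE; case: ifP.
Qed.

Lemma tonelli_unit (P : probability T R) (f : measurableTypeR R * T -> \bar R) :
  measurable_fun setT f -> (forall z, 0 <= f z)%E ->
  (\int[P]_w \int[mu]_(th in `[0%R, 1%R]) f (th, w) =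
   \int[mu]_(th in `[0%R, 1%R]) \int[P]_w f (th, w))%E.
Proof.
move=> mf f0.
pose D : set (measurableTypeR R * T) := `[0, 1]%classic `*` setT.
have mD : measurable D by apply: measurableX => //; exact: measurable_itv.
have pD th w : (f \_ D) (th, w) = ((fun th => f (th, w)) \_ `[0, 1]%classic) th.
  rewrite !patchE; congr (if _ then _ else _).
  by apply/idP/idP => /[!inE]; [case|split].
have mfD : measurable_fun setT (f \_ D).
  by apply/(measurable_restrict f mD measurableT); exact: measurable_funTS.
have fD0 z : (0 <= (f \_ D) z)%E by rewrite patchE; case: ifP.
transitivity (\int[P]_w \int[mu]_th (f \_ D) (th, w))%E.
  apply: eq_integral => w _; rewrite integral_mkcond.
  by apply: eq_integral => th _; rewrite pD.
rewrite -(@fubini_tonelli _ _ _ _ R mu P (f \_ D))// [RHS]integral_mkcond.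
apply: eq_integral => th _; rewrite [in RHS]patchE.
under eq_integral do rewrite pD patchE.
by case: ifP => // _; rewrite integral0.
Qed.

Lemma unit_Rintegral_EFin (f : R -> R) : continuous f ->
  ((\int[mu]_(th in `[0, 1]) f th)%R%:E = \int[mu]_(th in `[0%R, 1%R]) (f th)%:E)%E.
Proof.
by move=> cf; rewrite /Rintegral fineK//; apply: integrable_fin_num => //; exact: unit_integrable.
Qed.

Lemma likely_unit_integral (P : probability T R) (f : R -> T -> R) (c e : R) : 0 < e ->
  (forall w, continuous (f ^~ w)) -> (forall th, measurable_fun setT (f th)) ->
  (forall th w, 0 <= f th w) ->
  (forall th : R, (0 <= th <= 1)%R -> \int[P]_w (f th w)%:E <= c%:E)%E ->
  likely P (c / e) (fun w => \int[mu]_(th in `[0, 1]) f th w <= e).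
Proof.
move=> e0 cf mf f0 fc.
pose F (z : measurableTypeR R * T) := (f z.1 z.2)%:E.
have mF : measurable_fun setT F.
  by apply/measurable_EFinP; exact: measurable_continuous_process.
have F0 z : (0 <= F z)%E by rewrite lee_fin.
have [|||A [mA PA Aw]] := @likely_le _ _ _ P
  (fun w => \int[mu]_(th in `[0%R, 1%R]) F (th, w))%E c e e0.
- exact: measurable_segment_integral.
- by move=> w; apply: integral_ge0.
- rewrite tonelli_unit//; apply: (@le_trans _ _ (\int[mu]_(th in `[0%R, 1%R]) c%:E)%E).
    apply: ge0_le_integral => //.
    + by move=> th _; apply: integral_ge0.
    + apply: measurable_funTS.
      by have := @measurable_fun_fubini_tonelli_F _ _ _ _ R P F mF F0.
  by rewrite integral_cst//= lebesgue_measure_itv/= lte01 oppr0 adde0 mule1.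
exists A; split => // w /Aw; rewrite -lee_fin unit_Rintegral_EFin//.
Qed.

End unit_integral_bounds.

Section brownian_averages.
Context {d : measure_display} {T : measurableType d} {R : realType}.
Variables (P : probability T R) (F : R -> set (set T)) (B : R -> {RV P >-> R}).
Hypotheses (hF : usual_filtration P F) (hB : brownian_motion F B).
Variables (sg : R) (beta : R -> T -> R).
Hypotheses (sg2 : sg ^+ 2 = 1) (cbeta : forall w, continuous (beta ^~ w))
  (mbeta : forall s, measurable_fun setT (beta s))
  (betaE : forall s, 0 <= s <= 1 -> {ae P, forall w, beta s w = sg * B s w}).
Local Notation mu := (@lebesgue_measure R).

Lemma increment_square_ae (a c : R) : 0 <= a <= 1 -> 0 <= c <= 1 ->
  {ae P, forall w, (beta c w - beta a w) ^+ 2 = (B c w - B a w) ^+ 2}.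
Proof.
move=> a01 c01; move: (betaE a01) (betaE c01); apply: filterS2 => w -> ->.
by rewrite -mulrBr exprMn sg2 mul1r.
Qed.

Lemma comp_sq_measurable kap (a c : R) :
  measurable_fun setT (fun w => comp_sq kap (beta ^~ w) a c).
Proof.
apply: measurable_funB => //; apply: measurable_funX.
by apply: measurable_funB; exact: mbeta.
Qed.

(** The elementary bound [2 |x| <= x^2 / lam + lam] passes from the second moment
  to the first without square roots. *)
Lemma sum_comp_sq_L1 (n : nat) (J : pred nat) (a c : nat -> R) (m lam : R) :
  (forall k, (k < n)%N -> [/\ 0 <= a k, a k <= c k & c k <= 1]) ->
  (forall i k, (i < k)%N -> (k < n)%N -> c i <= a k) ->
  \sum_(k < n) (c k - a k) ^+ 2 <= m -> 0 < lam ->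
  (\int[P]_w `|\sum_(k < n | J k) comp_sq nvar (beta ^~ w) (a k) (c k)|%:E <=
   (2^-1 * (nfourth * m / lam + lam))%:E)%E.
Proof.
move=> ac01 ca sm lam0.
pose S w := \sum_(k < n | J k) comp_sq nvar (beta ^~ w) (a k) (c k).
have mS : measurable_fun setT S.
  by apply: (@measurable_sumn _ _ _ _ _ (fun k w => comp_sq nvar (beta ^~ w) (a k) (c k)))
    => k; exact: comp_sq_measurable.
have mS2 : measurable_fun setT (fun w => (S w ^+ 2)%:E).
  by apply/measurable_EFinP; exact: measurable_funX.
pose SB w := \sum_(k < n | J k) comp_sq nvar (fun t => B t w) (a k) (c k).
have mSB : measurable_fun setT SB.
  apply: (@measurable_sumn _ _ _ _ _ (fun k w => comp_sq nvar (fun t => B t w) (a k) (c k))) => k.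
  by apply: measurable_funB => //; apply: measurable_funX; exact: measurable_funB.
have S2 : (\int[P]_w (S w ^+ 2)%:E <= (nfourth * m)%:E)%E.
  rewrite (@ge0_ae_eq_integral _ _ _ _ _ _ (fun w => (SB w ^+ 2)%:E))//.
  - apply: (le_trans (sum_comp_sq_second_moment hF hB J ac01 ca)).
    by rewrite lee_fin ler_wpM2l ?nfourth_ge0.
  - by apply/measurable_EFinP; exact: measurable_funX.
  - by move=> w _; rewrite lee_fin sqr_ge0.
  - by move=> w _; rewrite lee_fin sqr_ge0.
  have : {ae P, forall w, forall k : 'I_n,
      comp_sq nvar (beta ^~ w) (a k) (c k) = comp_sq nvar (fun t => B t w) (a k) (c k)}.
    apply: filter_forall => k; have [a0 ac c1] := ac01 k (ltn_ord k).
    have a01 : 0 <= a k <= 1 by rewrite a0 (le_trans ac).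
    have c01 : 0 <= c k <= 1 by rewrite c1 (le_trans a0).
    by move: (increment_square_ae a01 c01); apply: filterS => w; rewrite /comp_sq => ->.
  by apply: filterS => w h _; rewrite /S /SB (eq_bigr _ (fun k _ => h k)).
apply: (@le_trans _ _ (\int[P]_w ((2^-1 / lam)%:E * (S w ^+ 2)%:E + (2^-1 * lam)%:E))%E).
  apply: ge0_le_integral => //.
  - by apply/measurable_EFinP; exact: measurableT_comp.
  - by apply: emeasurable_funD => //; exact: emeasurable_funM.
  move=> w _; rewrite -EFinM -EFinD lee_fin -/(S w) -(real_normK (num_real (S w))).
  move: (`|S w|) => x; rewrite -subr_ge0.
  have -> : 2^-1 / lam * x ^+ 2 + 2^-1 * lam - x = 2^-1 / lam * (x - lam) ^+ 2.
    by field; rewrite gt_eqF.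
  by rewrite mulr_ge0 ?sqr_ge0// divr_ge0// ltW.
have c0 : 0 <= 2^-1 / lam by rewrite divr_ge0// ltW.
rewrite ge0_integralD//.
- rewrite ge0_integralZl_EFin//; last by move=> w _; rewrite lee_fin sqr_ge0.
  rewrite integral_cst//= probability_setT mule1 mulrDr EFinD leeD2r//.
  have -> : 2^-1 * (nfourth * m / lam) = (2^-1 / lam) * (nfourth * m) by field; rewrite gt_eqF.
  by rewrite [X in (_ <= X)%E]EFinM; apply: lee_wpmul2l.
- by move=> w _; rewrite -EFinM lee_fin mulr_ge0 ?sqr_ge0.
- exact: emeasurable_funM.
- by move=> w _; rewrite lee_fin mulr_ge0// ltW.
Qed.

Variables (t : R) (p : seq R).
Hypotheses (t1 : t <= 1) (pp : itv_partition 0 t p).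

Lemma node_itv k th : (k < size p)%N -> 0 <= th <= 1 ->
  pt p k <= node p k th <= pt p k.+1.
Proof. by move=> kp th01; apply: affine_itv => //; exact/ltW/(pt_lt pp). Qed.

(** One factor of each square is at most the mesh, the other ones telescope. *)
Lemma sum_sq_le_mesh (f g : nat -> R) :
  (forall k, (k < size p)%N -> pt p k <= f k /\ f k <= g k /\ g k <= pt p k.+1) ->
  \sum_(k < size p) (g k - f k) ^+ 2 <= mesh p.
Proof.
move=> fg; apply: (@le_trans _ _ (\sum_(k < size p) mesh p * (pt p k.+1 - pt p k))).
  apply: ler_sum => k _; have [h1 [h2 h3]] := fg k (ltn_ord k).
  have hm := mesh_ge (ltn_ord k).
  rewrite expr2; apply: ler_pM; rewrite ?subr_ge0//; lra.
rewrite -mulr_sumr (sum_increments id pp) subr0.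
have /andP[t0 _] := pt_itv pp (leqnn _).
have m0 : 0 <= mesh p.
  by rewrite /mesh; elim/big_rec: _ => // i x _ x0; rewrite le_max x0 orbT.
have := pt_last pp => tE; rewrite tE in t0.
by rewrite ler_piMr.
Qed.

Lemma block_dev_L1 (J : pred nat) (th lam : R) : 0 <= th <= 1 -> 0 < lam ->
  (\int[P]_w (block_dev nvar (beta ^~ w) p J th)%:E <=
   (nfourth * mesh p / lam + lam)%:E)%E.
Proof.
move=> th01 lam0.
have pt01 k : (k <= size p)%N -> 0 <= pt p k <= 1.
  by move=> kp; have /andP[-> h] := pt_itv pp kp; rewrite (le_trans h).
rewrite /block_dev; under eq_integral do rewrite EFinD.
have mabs (f g : nat -> R) : measurable_fun setT (fun w =>
    `|\sum_(k < size p | J k) comp_sq nvar (beta ^~ w) (f k) (g k)|%:E).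
  apply/measurable_EFinP; apply: measurableT_comp => //.
  by apply: (@measurable_sumn _ _ _ _ _ (fun k w => comp_sq nvar (beta ^~ w) (f k) (g k)))
    => k; exact: comp_sq_measurable.
rewrite ge0_integralD//; [|exact: (mabs (fun k => node p k th) (fun k => pt p k.+1))
  |exact: (mabs (pt p) (fun k => node p k th))].
have -> : nfourth * mesh p / lam + lam = 2^-1 * (nfourth * mesh p / lam + lam)
  + 2^-1 * (nfourth * mesh p / lam + lam) by field; rewrite gt_eqF.
rewrite EFinD; apply: leeD.
  apply: (@sum_comp_sq_L1 _ _ (fun k => node p k th) (fun k => pt p k.+1)) => //.
  - move=> k kp; have /andP[h1 h2] := node_itv kp th01.
    have /andP[k0 _] := pt01 k (ltnW kp); have /andP[_ k1] := pt01 _ kp.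
    by split=> //; exact: le_trans h1.
  - move=> i k ik kp; have /andP[h1 _] := node_itv kp th01.
    by apply: le_trans h1; apply: (pt_le pp) => //; exact: ltnW.
  - apply: (@sum_sq_le_mesh (fun k => node p k th) (fun k => pt p k.+1)) => k kp; have /andP[h1 h2] := node_itv kp th01.
    by rewrite lexx.
apply: (@sum_comp_sq_L1 _ _ (pt p) (fun k => node p k th)) => //.
- move=> k kp; have /andP[h1 h2] := node_itv kp th01.
  have /andP[k0 _] := pt01 k (ltnW kp); have /andP[_ k1] := pt01 _ kp.
  by split=> //; exact: le_trans h2 _.
- move=> i k ik kp; have /andP[_ h2] := node_itv (ltn_trans ik kp) th01.
  by apply: (le_trans h2); apply: (pt_le pp) => //; exact: ltnW.
- apply: (@sum_sq_le_mesh (pt p) (fun k => node p k th)) => k kp; have /andP[h1 h2] := node_itv kp th01.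
  by rewrite lexx.
Qed.

Lemma sqsum_L1 (th : R) : 0 <= th <= 1 ->
  (\int[P]_w (\sum_(k < size p) sqsum (beta ^~ w) (pt p k) (node p k th) (pt p k.+1))%:E
   <= nvar%:E)%E.
Proof.
move=> th01.
have pt01 k : (k <= size p)%N -> 0 <= pt p k <= 1.
  by move=> kp; have /andP[-> h] := pt_itv pp kp; rewrite (le_trans h).
have msq (a c : R) : measurable_fun setT (fun w => ((beta c w - beta a w) ^+ 2)%:E).
  by apply/measurable_EFinP; apply: measurable_funX; apply: measurable_funB; exact: mbeta.
have Esq (a c : R) : 0 <= a -> a <= c -> c <= 1 ->
    (\int[P]_w ((beta c w - beta a w) ^+ 2)%:E = (nvar * (c - a))%:E)%E.
  move=> a0 ac c1; rewrite -(increment_second_moment hB a0 ac c1).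
  apply: ge0_ae_eq_integral => //.
  - by apply/measurable_EFinP; apply: measurable_funX; exact: measurable_funB.
  - by move=> w _; rewrite lee_fin sqr_ge0.
  - by move=> w _; rewrite lee_fin sqr_ge0.
  have a01 : 0 <= a <= 1 by rewrite a0 (le_trans ac).
  have c01 : 0 <= c <= 1 by rewrite c1 (le_trans a0).
  by move: (increment_square_ae a01 c01); apply: filterS => w -> _.
under eq_integral do rewrite -sumEFin.
rewrite ge0_integral_sum//; first last.
- by move=> k w _; rewrite lee_fin addr_ge0 ?sqr_ge0.
- by move=> k; rewrite /sqsum; under eq_fun do rewrite EFinD; exact: emeasurable_funD.
rewrite (eq_bigr (fun k : 'I_(size p) => (nvar * (pt p k.+1 - pt p k))%:E)); last first.
  move=> k _; have /andP[h1 h2] := node_itv (ltn_ord k) th01.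
  have /andP[k0 _] := pt01 k (ltnW (ltn_ord k)); have /andP[_ k1] := pt01 _ (ltn_ord k).
  rewrite /sqsum; under eq_integral do rewrite EFinD.
  rewrite ge0_integralD//; first last.
  - by move=> w _; rewrite lee_fin sqr_ge0.
  - by move=> w _; rewrite lee_fin sqr_ge0.
  rewrite !Esq//; [|exact: le_trans h2 _|exact: le_trans h1].
  by rewrite -EFinD; congr EFin; ring.
rewrite sumEFin lee_fin -mulr_sumr (sum_increments id pp) subr0.
by rewrite ler_piMr// nvar_ge0.
Qed.

End brownian_averages.

(** * Convergence in probability *)

Section stratonovich_convergence.
Context {d : measure_display} {T : measurableType d} {R : realType}.
Variables (P : probability T R) (F : R -> set (set T)) (B : R -> {RV P >-> R}).
Hypotheses (hF : usual_filtration P F) (hB : brownian_motion F B).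
Variables (sg : R) (beta : R -> T -> R).
Hypotheses (sg2 : sg ^+ 2 = 1) (cbeta : forall w, continuous (beta ^~ w))
  (mbeta : forall s, measurable_fun setT (beta s))
  (betaE : forall s, 0 <= s <= 1 -> {ae P, forall w, beta s w = sg * B s w}).

Lemma block_dev_measurable kap p (J : pred nat) th :
  measurable_fun setT (fun w => block_dev kap (beta ^~ w) p J th).
Proof.
have mS (f g : nat -> R) : measurable_fun setT (fun w =>
    `|\sum_(k < size p | J k) comp_sq kap (beta ^~ w) (f k) (g k)|).
  apply: measurableT_comp => //.
  by apply: (@measurable_sumn _ _ _ _ _ (fun k w => comp_sq kap (beta ^~ w) (f k) (g k)))
    => k; exact: comp_sq_measurable.
apply: measurable_funD.
  exact: (mS (fun k => node p k th) (fun k => pt p k.+1)).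
exact: (mS (pt p) (fun k => node p k th)).
Qed.

Lemma likely_block_dev (t : R) (N : nat) (e h : R) : t <= 1 -> 0 < e -> 0 < h ->
  exists2 delta : R, 0 < delta & forall p, itv_partition 0 t p -> mesh p < delta ->
    likely P h (fun w => \sum_(j < N.+1) `|\sum_(k < size p | block N p k == j)
      avg (fun s => sqdiff (beta ^~ w) (pt p k) s (pt p k.+1)) (pt p k) (pt p k.+1)| <= e).
Proof.
move=> t1 e0 h0.
have N0 : 0 < N.+1%:R :> R by [].
(* each block costs [2 * lam] once the mesh is below [lam ^ 2 / nfourth], and
   Markov's inequality at level [e] divides the total by [e] *)
pose lam := e * h / (2 * N.+1%:R).
have lam0 : 0 < lam by rewrite divr_gt0 ?mulr_gt0.
have nf0 : 0 < nfourth + 1 :> R by have := @nfourth_ge0 R; lra.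
exists (lam ^+ 2 / (nfourth + 1)); first by rewrite divr_gt0 ?exprn_gt0.
move=> p pp pm.
pose f (th : R) (w : T) := \sum_(j < N.+1)
  block_dev nvar (beta ^~ w) p (fun k => block N p k == j) th.
have fc th : 0 <= th <= 1 -> (\int[P]_w (f th w)%:E <= (h * e)%:E)%E.
  move=> th01; rewrite /f; under eq_integral do rewrite -sumEFin.
  have mdev (J : pred nat) : measurable_fun setT (fun w => (block_dev nvar (beta ^~ w) p J th)%:E).
    by apply/measurable_EFinP; exact: block_dev_measurable.
  rewrite ge0_integral_sum//; last by move=> j w _; rewrite lee_fin addr_ge0.
  apply: (@le_trans _ _ (\sum_(j < N.+1) (2 * lam)%:E)%E).
    apply: lee_sum => j _.
    apply: (le_trans (block_dev_L1 hF hB sg2 mbeta betaE t1 pp _ th01 lam0)).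
    rewrite lee_fin mulr_natl mulr2n lerD2r ler_pdivrMr// -expr2.
    have : (nfourth + 1) * mesh p <= lam ^+ 2 by rewrite -ler_pdivlMl// mulrC ltW.
    have m0 : 0 <= mesh p by rewrite /mesh; elim/big_rec: _ => // i x _ x0; rewrite le_max x0 orbT.
    by lra.
  rewrite sumEFin lee_fin sumr_const card_ord.
  suff -> : 2 * lam *+ N.+1 = h * e by [].
  rewrite -[LHS]mulr_natl /lam; move: (N.+1%:R : R) N0 => n n0.
  by field; rewrite (gt_eqF n0).
have -> : h = h * e / e by rewrite mulfK// gt_eqF.
have cdev w (J : pred nat) := @block_dev_continuous R nvar (beta ^~ w) p J (@cbeta w).
have cf w : continuous (f ^~ w).
  by apply: (@continuous_sumn _ _ xpredT
    (fun j th => block_dev nvar (beta ^~ w) p (fun k => block N p k == j) th)) => j; exact: cdev.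
have [||A [mA PA Aw]] := @likely_unit_integral _ _ _ P f (h * e) e e0 cf _ _ fc.
- move=> th; apply: (@measurable_sumn _ _ _ _ xpredT
    (fun j w => block_dev nvar (beta ^~ w) p (fun k => block N p k == j) th)) => j.
  exact: block_dev_measurable.
- by move=> th w; apply: sumr_ge0 => j _; rewrite addr_ge0.
exists A; split=> // w /Aw; apply: le_trans.
rewrite /f (@unit_Rintegral_sum _ _ xpredT
    (fun j th => block_dev nvar (beta ^~ w) p (fun k => block N p k == j) th)) => [|j]; last exact: cdev.
by apply: ler_sum => j _; exact: sum_avg_sqdiff_le.
Qed.

Lemma likely_sqsum (t : R) (p : seq R) (q : R) : t <= 1 -> itv_partition 0 t p -> 0 < q ->
  likely P (nvar / q) (fun w => \sum_(k < size p)
    avg (fun s => sqsum (beta ^~ w) (pt p k) s (pt p k.+1)) (pt p k) (pt p k.+1) <= q).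
Proof.
move=> t1 pp q0.
pose f (th : R) (w : T) := \sum_(k < size p)
  sqsum (beta ^~ w) (pt p k) (node p k th) (pt p k.+1).
have csq w k : continuous (fun th : R => sqsum (beta ^~ w) (pt p k) (node p k th) (pt p k.+1)).
  apply: (@continuous_affine_comp _ (fun s => sqsum (beta ^~ w) (pt p k) s (pt p k.+1))).
  exact: sqsum_continuous.
have [|||th th01|A [mA PA Aw]] := @likely_unit_integral _ _ _ P f nvar q q0.
- by move=> w; apply: (@continuous_sumn _ _ xpredT
    (fun k th => sqsum (beta ^~ w) (pt p k) (node p k th) (pt p k.+1))) => k; exact: csq.
- move=> th; apply: (@measurable_sumn _ _ _ _ xpredT
    (fun k w => sqsum (beta ^~ w) (pt p k) (node p k th) (pt p k.+1))) => k.
  by apply: measurable_funD; apply: measurable_funX; apply: measurable_funB; exact: mbeta.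
- by move=> th w; apply: sumr_ge0 => j _; rewrite addr_ge0 ?sqr_ge0.
- exact: (sqsum_L1 hB sg2 mbeta betaE t1 pp th01).
exists A; split=> // w /Aw; rewrite /f (@unit_Rintegral_sum _ _ xpredT
    (fun k th => sqsum (beta ^~ w) (pt p k) (node p k th) (pt p k.+1)))//.
Qed.

Lemma likely_weaken (h h' : R) (Q Q' : T -> Prop) : h <= h' ->
  (forall w, Q w -> Q' w) -> likely P h Q -> likely P h' Q'.
Proof.
move=> hh QQ [A [mA PA Aw]]; exists A; split=> //; last by move=> w /Aw /QQ.
by apply: (le_trans PA); rewrite lee_fin.
Qed.

(** The bounds of [strat_sum_error] hold off small events: first the blocks are
  chosen so short that all moduli of continuity are below [eta], which fixes
  their number; then the mesh is refined until the sums over each block are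
  small. The primitive [G w] may depend on the whole path, since it enters the
  random sums only through these pathwise bounds. *)
Lemma likely_strat_sum (G g g1 : T -> R -> R) (r : R -> T -> R) (s0 : R) :
  (forall w (x : R), is_derive x 1 (G w) (g w x)) ->
  (forall w (x : R), is_derive x 1 (g w) (g1 w x)) ->
  (forall w, continuous (g1 w)) ->
  (forall w, continuous (r ^~ w)) -> (forall s, measurable_fun setT (r s)) ->
  (forall s, measurable_fun setT (fun w => g w (beta s w + r s w))) ->
  (forall s, measurable_fun setT (fun w => g1 w (beta s w + r s w))) ->
  (forall w x y, 0 <= x -> x <= y -> y <= 1 -> r x w <= r y w) ->
  (forall w x y, 0 <= x -> x <= y -> y <= 1 -> r x w < r y w ->
    exists2 z, x <= z <= y & g w (beta z w + r z w) = s0) ->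
  forall t e h : R, 0 <= t <= 1 -> 0 < e -> 0 < h ->
  exists2 delta : R, 0 < delta & forall p, itv_partition 0 t p -> mesh p < delta ->
    likely P h (fun w =>
      `|\sum_(k < size p) avg (fun s => g w (beta s w + r s w)) (pt p k) (pt p k.+1) *
          (beta (pt p k.+1) w - beta (pt p k) w)
        - (G w (beta t w + r t w) - G w (beta 0 w + r 0 w) - s0 * (r t w - r 0 w))| <= e).
Proof.
move=> Gd gd cg1 cr mr mg mg1 rnd grow t e h /andP[t0 t1] e0 h0.
have cU w : continuous (fun s => beta s w + r s w) by exact: continuous_add.
have cgU w : continuous (fun s => g w (beta s w + r s w)).
  exact: (continuous_compose (is_derive_continuous (gd w)) (cU w)).
have cg1U w : continuous (fun s => g1 w (beta s w + r s w)).
  exact: (continuous_compose (cg1 w) (cU w)).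
(* eight exceptional events of probability at most [h / 8] each, and three
   error terms of at most [e / 3] each *)
have h8 : 0 < h / 8 by rewrite divr_gt0.
have [n1 likK] := likely_bounded P cg1U mg1 h8.
have [n2 likr] := likely_bounded P cr mr h8.
set K : R := n1%:R in likK; set Kr : R := n2%:R in likr.
have K0 : 0 <= K by exact: ler0n.
have Kr0 : 0 <= Kr by exact: ler0n.
pose q : R := 8 * nvar / h + 1.
have q0 : 0 < q by rewrite ltr_wpDl// divr_ge0 ?mulr_ge0 ?nvar_ge0// ltW.
pose c : R := (2 * K + 4) * (2 * Kr) + 1.
have c0 : 0 < c by rewrite ltr_wpDl// !mulr_ge0//; lra.
pose eta : R := Num.min 1 (Num.min (e / 3 / q) (e / 3 / c)).
have eta0 : 0 < eta by rewrite !lt_min ltr01 !divr_gt0.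
have [eta1 etaq etac] : [/\ eta <= 1, eta * q <= e / 3 & eta * c <= e / 3].
  rewrite -!ler_pdivlMr//; split; rewrite /eta; first by rewrite ge_min lexx.
    by rewrite !ge_min lexx orbT.
  by rewrite !ge_min lexx !orbT.
have [m1 lik1] := likely_modulus P cbeta mbeta eta0 h8.
have [m2 lik2] := likely_modulus P cr mr eta0 h8.
have [m3 lik3] := likely_modulus P cgU mg eta0 h8.
have [m4 lik4] := likely_modulus P cg1U mg1 eta0 h8.
pose M := maxn (maxn m1 m2) (maxn m3 m4); pose N := (2 * M.+1)%N.
have N0 : (0 < N)%N by [].
have N2 : 2 / N%:R = M.+1%:R^-1 :> R.
  by rewrite /N natrM invfM mulrA divff ?mul1r// pnatr_eq0.
have leM m : (m <= M)%N -> 2 / N%:R <= m.+1%:R^-1 :> R.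
  by move=> mM; rewrite N2 lef_pV2 ?posrE ?ltr0n// ler_nat ltnS.
have K1 : 0 < K + 1 by lra.
have e' : 0 < e / 3 / (K + 1) by rewrite !divr_gt0.
have [delta delta0 likV] := likely_block_dev N t1 e' h8.
exists (Num.min delta N%:R^-1); first by rewrite lt_min delta0 invr_gt0 ltr0n.
move=> p pp; rewrite lt_min => /andP[pd pN].
have likQ := likely_sqsum t1 pp q0.
have L := likelyI (likelyI (likelyI likK likr) (likelyI lik1 lik2))
   (likelyI (likelyI lik3 lik4) (likelyI likQ (likV p pp pd))).
apply: likely_weaken L.
  have : nvar / q <= h / 8.
    rewrite ler_pdivrMr// /q mulrDr mulr1.
    have -> : h / 8 * (8 * nvar / h) = nvar by field; rewrite gt_eqF.
    by rewrite lerDl ltW.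
  by lra.
move=> w [[[bK br] [b1 b2]] [[b3 b4] [bQ bV]]].
have := @strat_sum_error R (G w) (g w) (g1 w) (beta ^~ w) (r ^~ w) s0 eta K t N p
  (Gd w) (gd w) (@cbeta w) (cr w) _ t1 N0 pp (ltW pN) (rnd w) _ bK (grow w).
rewrite (ltW eta0) eta1 => /(_ isT) H.
apply: (le_trans (H _)) => {H}.
  move=> x y x01 y01 xy; split.
  - by apply: b1 => //; apply: (le_trans xy); apply: leM; rewrite !leq_max leqnn ?orbT.
  - by apply: b2 => //; apply: (le_trans xy); apply: leM; rewrite !leq_max leqnn ?orbT.
  - by apply: b3 => //; apply: (le_trans xy); apply: leM; rewrite !leq_max leqnn ?orbT.
  - by apply: b4 => //; apply: (le_trans xy); apply: leM; rewrite !leq_max leqnn ?orbT.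
have t01 : 0 <= t <= 1 by rewrite t0.
have z01 : is_true ((0 <= 0 :> R) && (0 <= 1 :> R)) by rewrite lexx ler01.
have V3 : K * \sum_(j < N.+1) `|\sum_(k < size p | block N p k == j)
      avg (fun s => sqdiff (beta ^~ w) (pt p k) s (pt p k.+1)) (pt p k) (pt p k.+1)| <= e / 3.
  apply: (le_trans (ler_wpM2l K0 bV)).
  rewrite mulrA ler_pdivrMr// mulrC; apply: ler_wpM2l; last by rewrite lerDl.
  by rewrite divr_ge0// ltW.
have Q3 := le_trans (ler_wpM2l (ltW eta0) bQ) etaq.
have R3 : (2 * K + 4) * (eta * (r t w - r 0 w)) <= e / 3.
  apply: le_trans etac; rewrite mulrCA ler_pM2l// /c.
  have rr : r t w - r 0 w <= 2 * Kr.
    by have := br _ t01; have := br _ z01; rewrite !ler_norml; lra.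
  have K4 : 0 <= 2 * K + 4 by lra.
  by have := ler_wpM2l K4 rr; lra.
by lra.
Qed.

End stratonovich_convergence.

(** * Growth on the zero set *)

Section stieltjes.
Context {R : realType}.

Lemma negligible_bigcup_countType d (T : measurableType d)
    (mu : {measure set T -> \bar R}) (I : countType) (C : I -> set T) :
  (forall i, mu.-negligible (C i)) -> mu.-negligible (\bigcup_i C i).
Proof.
move=> C0; pose D n := if unpickle n is Some i then C i else set0.
have D0 : mu.-negligible (\bigcup_n D n).
  apply: negligible_bigcup => n; rewrite /D.
  by case: unpickle => [i|]; [exact: C0|exact: negligible_set0].
apply: negligibleS D0 => s [i _ Ci].
by exists (pickle i) => //; rewrite /D pickleK.
Qed.

Lemma lebesgue_stieltjes_measure_itv_oc (G : cumulative R R) (a b : R) : a <= b ->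
  lebesgue_stieltjes_measure G `]a, b]%classic = (G b - G a)%:E.
Proof.
move=> ab; rewrite /lebesgue_stieltjes_measure /measure_extension.
by rewrite measurable_mu_extE/= ?wlength_itv_bnd//; exact: is_ocitv.
Qed.

Lemma rat_between_near (s e : R) : 0 < e ->
  exists p q : rat, [/\ ratr p < s, s < ratr q :> R, s - e < ratr p & ratr q < s + e].
Proof.
move=> e0.
have [p] : exists p : rat, ratr p \in `]s - e, s[ by apply: rat_in_itvoo; lra.
have [q] : exists q : rat, ratr q \in `]s, s + e[ by apply: rat_in_itvoo; lra.
by rewrite !in_itv/= => /andP[h1 h2] /andP[h3 h4]; exists p, q.
Qed.

(** Around a time where [X] does not vanish, [L] is constant; hence the complement
  of the zero set is covered by countably many intervals with rational end
  points that carry no mass. *)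
Lemma stieltjes_supported_on_zeros (X L : R -> R) : continuous X -> continuous L ->
  L 0 = 0 -> (forall x y, 0 <= x -> x <= y -> y <= 1 -> L x <= L y) ->
  (forall x y, 0 <= x -> x <= y -> y <= 1 -> L x < L y ->
    exists2 z, x <= z <= y & X z = 0) ->
  forall t, 0 <= t <= 1 -> is_stieltjes_integral (\1_[set s | X s = 0]) L t (L t).
Proof.
move=> cX cL L0 Lnd grow t t01.
have Lclamp x y : x <= y -> L (clamp x) <= L (clamp y).
  move=> xy; have /andP[x0 _] := clamp_itv x; have /andP[_ y1] := clamp_itv y.
  by apply: Lnd => //; exact: clamp_homo.
have ndG : nondecreasing (fun s => L (clamp s)) by move=> x y xy; exact: Lclamp.
have rcG : right_continuous (fun s => L (clamp s)).
  by apply: right_continuousW; exact: (continuous_compose cL (@clamp_continuous R)).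
pose G : cumulative R R := HB.pack (fun s => L (clamp s))
  (isCumulative.Build R _ R (fun s => L (clamp s)) ndG rcG).
exists G => //.
pose mu := lebesgue_stieltjes_measure G.
pose Z := [set s | X s = 0].
have mZ : measurable Z.
  have -> : Z = X @^-1` [set 0] by [].
  rewrite -[_ @^-1` _]setTI; apply: continuous_measurable_fun => //.
have cover : `]-1, t]%classic `\` (`[0, t] `&` Z) `<=`
    \bigcup_(p : rat) \bigcup_(q : rat)
      (if (ratr p <= ratr q :> R) && (G (ratr p) == G (ratr q)) then `]ratr p, ratr q]%classic else set0).
  move=> s [/=]; rewrite in_itv/= => /andP[s1 st] nZ.
  suff [e e0 he] : exists2 e, 0 < e & forall x y, s - e < x -> x < s -> s < y ->
      y < s + e -> L (clamp x) = L (clamp y).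
    have [p [q [ps sq pe qe]]] := rat_between_near s e0.
    exists p => //; exists q => //.
    rewrite (ltW (lt_trans ps sq)) (he _ _ pe ps sq qe) eqxx/= in_itv/= ps/= ltW//.
  have [s0|s0] := ltP s 0.
    exists (- s); first by rewrite oppr_gt0.
    have clamp0 x : x < 0 -> clamp x = 0.
      move=> x0; have := clamp_homo (ltW x0); rewrite [X in _ <= X]clamp_id ?lexx ?ler01//.
      by have /andP[] := clamp_itv x; lra.
    by move=> x y _ xs sy ye; rewrite !clamp0//; lra.
  have Xs : X s != 0.
    by apply/eqP => Xs; apply: nZ; rewrite in_itv/= s0 st.
  have [e e0 he] := continuous_near_point s cX (ltac:(by rewrite normr_gt0) : 0 < `|X s|).
  exists e => // x y sx xs sy ys.
  apply/eqP; rewrite eq_le Lclamp ?(ltW (lt_trans xs sy))//= leNgt; apply/negP => lt_xy.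
  have /andP[x0 _] := clamp_itv x; have /andP[_ y1] := clamp_itv y.
  have /andP[t0 t1] := t01.
  have cs : clamp s = s by rewrite clamp_id// s0 (le_trans st).
  have [z /andP[xz zy] Xz] := grow _ _ x0 (clamp_homo (ltW (lt_trans xs sy))) y1 lt_xy.
  have : `|X z - X s| < `|X s|.
    apply: he; have := clamp_lipschitz x s; have := clamp_lipschitz y s.
    by rewrite cs !mul1r !ler_norml ltr_norml (ltr0_norm (ltac:(lra) : x - s < 0))
      (gtr0_norm (ltac:(lra) : 0 < y - s)); lra.
  by rewrite Xz sub0r normrN ltxx.
have mI : measurable (`]-1, t]%classic : set (measurableTypeR R)) by exact: measurable_itv.
have mJ : measurable (`[0, t]%classic : set (measurableTypeR R)) by exact: measurable_itv.
have mZ' : measurable (Z : set (measurableTypeR R)) := mZ.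
have null : mu (`]-1, t]%classic `\` (`[0, t] `&` Z)) = 0%E.
  apply/eqP; rewrite eq_le measure_ge0 andbT.
  pose C (p q : rat) : set (measurableTypeR R) :=
    if (ratr p <= ratr q :> R) && (G (ratr p) == G (ratr q)) then `]ratr p, ratr q]%classic else set0.
  have C0 p q : mu.-negligible (C p q).
    rewrite /C; case: ifP => [/andP[pq /eqP Gpq]|_]; last exact: negligible_set0.
    apply/negligibleP; first exact: measurable_itv.
    by apply: (eq_trans (lebesgue_stieltjes_measure_itv_oc G pq)); rewrite Gpq subrr.
  have [A [mA A0 CA]] : mu.-negligible (\bigcup_p \bigcup_q C p q).
    apply: negligible_bigcup_countType => p.
    by apply: negligible_bigcup_countType => q; exact: C0.
  apply: (@le_trans _ _ (mu A)); last by rewrite [mu A]A0.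
  apply: le_measure; rewrite ?inE//; last exact: (subset_trans cover CA).
  by apply: measurableD => //; exact: measurableI.
have mE : mu `]-1, t]%classic = (L t)%:E.
  have t1 : -1 <= t by have /andP[] := t01; lra.
  apply: (eq_trans (lebesgue_stieltjes_measure_itv_oc G t1)); rewrite /G/= clamp_id//.
  have -> : clamp (-1) = 0 :> R.
    rewrite /clamp min_l; last by rewrite lerN10 || lra.
    by rewrite max_l// lerN10.
  by rewrite L0 subr0.
rewrite integral_indic//= setIC -mE.
have -> : `]-1, t]%classic = (`]-1, t]%classic `\` (`[0, t] `&` Z)) `|` (`[0, t] `&` Z) :> set R.
  rewrite setUC setDUK//; apply: subset_trans (@subIsetl _ _ _) _.
  by apply: subset_itvr; rewrite bnd_simp.
apply/esym; apply: (eq_trans (measureU mu _ _ _)).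
- by apply: measurableD => //; exact: measurableI.
- exact: measurableI.
- by rewrite setDE -setIA setICl setI0.
- by rewrite [X in (X + _)%E]null add0e.
Qed.

End stieltjes.

(** * Measurability of the pathwise constructions *)

Section measurability.
Context {d : measure_display} {T : measurableType d} {R : realType}.
Local Notation mu := (@lebesgue_measure R).

Lemma clamp_extension_continuous (f : R -> R) : {within `[0, 1], continuous f} ->
  continuous (fun t => f (clamp t)).
Proof.
move=> /subspace_continuousP cf t.
have ct : [set` `[0, 1]] (clamp t) by rewrite /= in_itv/=; exact: clamp_itv.
have /cvgrPdist_lt fct := cf _ ct.
apply/cvgrPdist_lt => e e0.
have := fct e e0; rewrite /= /within/= => H.
have [r /= r0 hr] := H.
near=> u; apply: hr => /=.
- apply: (le_lt_trans (clamp_lipschitz _ _)); rewrite mul1r.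
  near: u; exact: cvgr_dist_lt.
- by rewrite in_itv/=; exact: clamp_itv.
Unshelve. all: by end_near. Qed.

(** By continuity the maximum may be tested at rational fractions of [t], which
  makes [runmax] measurable in the path. *)
Lemma runmax_gt_rat (f : R -> R) (t c : R) : continuous f -> 0 <= t ->
  c < runmax f t <-> exists p : rat, c < f (t * clamp (ratr p)).
Proof.
move=> cf t0; split => [|[p cp]]; last first.
  have /andP[p0 p1] := clamp_itv (ratr p : R).
  by apply: (lt_le_trans cp); apply: runmax_ge => //; rewrite mulr_ge0//= ler_piMr.
have [s /andP[s0 st] [-> _]] := runmax_attained cf t0; move=> cs.
have [t00|t_gt0] := leP t 0.
  exists 0; suff -> : t * clamp (ratr 0) = s by [].
  have -> : t = 0 by lra.
  by rewrite mul0r; lra.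
have cg : continuous (fun x : R => f (t * x)).
  exact: (continuous_compose cf (@mulrl_continuous R t)).
have st01 : 0 <= s / t <= 1 by rewrite divr_ge0//= ler_pdivrMr// mul1r.
have [p /andP[p0 p1] [_]] := rat_approx cg st01 (ltac:(by rewrite subr_gt0) : 0 < f s - c).
rewrite [t * (s / t)]mulrC divfK ?gt_eqF// ltr_norml => /andP[h _].
by exists p; rewrite clamp_id ?(ltW p0) ?(ltW p1)//; lra.
Qed.

Lemma measurable_of_superlevel (f : T -> R) :
  (forall c : R, measurable [set w | c < f w]) -> measurable_fun setT f.
Proof.
move=> mf; apply: (measurability _ (RGenOInfty.measurableE R)) => //= _ [_ [r ->] <-].
rewrite setTI; have -> : f @^-1` `]r, +oo[%classic = [set w | r < f w].
  by apply/seteqP; split => w /=; rewrite in_itv/= andbT.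
exact: mf.
Qed.

Lemma measurable_runmax (V : R -> T -> R) (t : R) : (forall w, continuous (V ^~ w)) ->
  (forall s, measurable_fun setT (V s)) -> 0 <= t ->
  measurable_fun setT (fun w => runmax (V ^~ w) t).
Proof.
move=> cV mV t0; apply: measurable_of_superlevel => c.
have -> : [set w | c < runmax (V ^~ w) t] =
    \bigcup_(p : rat) [set w | c < V (t * clamp (ratr p)) w].
  apply/seteqP; split => w /=.
    by move/(runmax_gt_rat _ (cV w) t0) => [p hp]; exists p.
  by move=> [p _ hp]; apply/(runmax_gt_rat _ (cV w) t0); exists p.
apply: bigcupT_measurable_rat => p.
rewrite -[X in measurable X]setTI.
have -> : [set w | c < V (t * clamp (ratr p)) w] =
    V (t * clamp (ratr p)) @^-1` `]c, +oo[%classic.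
  by apply/seteqP; split => w /=; rewrite in_itv/= andbT.
exact: mV.
Qed.

(** The flow is continuous in time and, by continuous dependence, in the initial
  value; hence it is jointly measurable. *)
Lemma measurable_flow (s : R -> R) (k : R) (phi : R -> R -> R) (z u : T -> R) : 0 < k ->
  (forall x y, `|s x - s y| <= k * `|x - y|) ->
  (forall x, phi x 0 = x) -> (forall x, solution s (phi x)) ->
  measurable_fun setT z -> measurable_fun setT u ->
  measurable_fun setT (fun w => phi (z w) (u w)).
Proof.
move=> k0 sk phi0 phis mz mu'.
have cphi (x : R) : continuous (fun u => phi x u) := is_derive_continuous (phis x).
have mphi (x : R) : measurable_fun setT (fun y : R => phi y x).
  apply: continuous_measurable_fun.
  apply: (@lipschitz_continuous _ _ (expR (k * `|x|))) => y y'.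
  rewrite mulrC; have := solution_dependence k0 sk (phis y) (phis y') x.
  by rewrite !phi0.
have mpair : measurable_fun setT (fun w => (u w, z w) : measurableTypeR R * R).
  have mu2 : measurable_fun setT (u : T -> measurableTypeR R) := mu'.
  exact: measurable_fun_pair.
exact: (measurableT_comp (@measurable_continuous_process _ R R (fun u y => phi y u) cphi mphi)
  mpair).
Qed.

Lemma measurable_Rintegral_segment (V : R -> T -> R) (a c : R) :
  (forall w, continuous (V ^~ w)) -> (forall s, measurable_fun setT (V s)) ->
  measurable_fun setT (fun w => \int[mu]_(s in `[a, c]) V s w)%R.
Proof.
move=> cV mV.
have mVV := measurable_continuous_process cV mV.
rewrite /Rintegral; apply: measurableT_comp => //.
pose VV (z : measurableTypeR R * T) := (V z.1 z.2)%:E.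
have split_parts w : (\int[mu]_(s in `[a, c]) (V s w)%:E =
    \int[mu]_(s in `[a, c]) (VV^\+ (s, w)) - \int[mu]_(s in `[a, c]) (VV^\- (s, w)))%E.
  rewrite integralE; congr (_ - _)%E; apply: eq_integral => s _.
    by rewrite !funeposE.
  by rewrite !funenegE.
under eq_fun do rewrite split_parts.
have mVVE : measurable_fun setT VV by exact/measurable_EFinP.
apply: emeasurable_funB; apply: measurable_segment_integral.
- exact: measurable_funepos.
- by move=> z; exact: funepos_ge0.
- exact: measurable_funeneg.
- by move=> z; exact: funeneg_ge0.
Qed.

Lemma measurable_strat_sum (B V : R -> T -> R) (p : seq R) :
  (forall w, continuous (V ^~ w)) -> (forall s, measurable_fun setT (V s)) ->
  (forall s, measurable_fun setT (B s)) ->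
  measurable_fun setT (strat_sum B V p).
Proof.
move=> cV mV mB; rewrite /strat_sum.
apply: (@measurable_sumn R _ _ (size p) xpredT (fun k w => (pt p k.+1 - pt p k)^-1 *
  (\int[mu]_(s in `[pt p k, pt p k.+1]) V s w)%R * (B (pt p k.+1) w - B (pt p k) w))) => k.
apply: measurable_funM; last exact: measurable_funB.
by apply: measurable_funM => //; exact: measurable_Rintegral_segment.
Qed.

End measurability.

(** * A single reflected path *)

Section reflected_path.
Context {R : realType}.
Variables (p b rh : R -> R).
Hypotheses (cb : continuous b) (b0 : b 0 = 0).
Hypothesis rhE : (exists2 a : R, 0 <= a & [/\ p (- a) = 0,
        (forall u : R, - a <= u -> 0 <= p u) &
        forall m, rh m = Num.max 0 (m - a)]) \/
      ((forall u, 0 <= p u) /\ forall m, rh m = 0).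
Let r t := rh (runmax (fun s => - b s) (clamp t)).

Let cNb : continuous (fun s => - b s).
Proof.
have -> : (fun s => - b s) = (fun s => 0 - b s) by apply/funext => s; rewrite sub0r.
by apply: continuous_sub => //; exact: continuous_const.
Qed.

Let runmax0 : runmax (fun s => - b s) (clamp 0) = 0.
Proof.
have [s] := @runmax_attained _ (fun s => - b s) 0 cNb (lexx _).
rewrite -eq_le => /eqP <- [rE _].
by rewrite clamp_id ?lexx ?ler01// rE b0 oppr0.
Qed.

Lemma push_continuous : continuous r.
Proof.
have cm := runmax_clamp_continuous cNb.
case: rhE => [[a a0 [_ _ rE]]|[_ rE]] x.
  rewrite /r; under eq_fun do rewrite rE.
  have cd : continuous (fun t => runmax (fun s => - b s) (clamp t) - a).
    by apply: continuous_sub => //; exact: continuous_const.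
  exact: (@continuous_max _ _ (fun=> 0) _ x (@cvg_cst _ _ _ _ _) (cd x)).
by rewrite /r; under eq_fun do rewrite rE; exact: cvg_cst.
Qed.

Lemma push_start : r 0 = 0.
Proof.
rewrite /r runmax0; case: rhE => [[a a0 [_ _ ->]]|[_ ->]//].
by rewrite max_l// sub0r oppr_le0.
Qed.

Lemma push_homo x y : x <= y -> r x <= r y.
Proof.
move=> xy; rewrite /r; have := runmax_homo cNb (proj1 (andP (clamp_itv x))) (clamp_homo xy).
case: rhE => [[a a0 [_ _ rE]]|[_ rE]] le_m; rewrite !rE//.
by rewrite ge_max !le_max lexx/=; apply/orP; right; lra.
Qed.

(** In the first case the argument [b + r] of [p] never falls below [- a]. *)
Lemma pushed_path_ge0 t : 0 <= t <= 1 -> 0 <= p (b t + r t).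
Proof.
move=> t01; case: rhE => [[a a0 [_ pge0 rE]]|[pge0 _]]; last exact: pge0.
apply: pge0; rewrite /r rE clamp_id//.
have := @runmax_ge _ (fun s => - b s) t t cNb (ltac:(by case/andP: t01 => -> _; rewrite lexx)).
have : runmax (fun s => - b s) t - a <= Num.max 0 (runmax (fun s => - b s) t - a).
  by rewrite le_max lexx orbT.
by rewrite /=; lra.
Qed.

Lemma push_only_at_boundary x y : 0 <= x -> x <= y -> y <= 1 -> r x < r y ->
  exists2 z, x <= z <= y & p (b z + r z) = 0.
Proof.
move=> x0 xy y1; have x01 : 0 <= x <= 1 by rewrite x0 (le_trans xy).
have y01 : 0 <= y <= 1 by rewrite y1 (le_trans x0).
rewrite /r; case: rhE => [[a a0 [pa _ rE]]|[_ rE]]; last by rewrite !rE ltxx.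
rewrite !rE !clamp_id// => grow.
have [z /andP[xz zy]] := push_growth cNb x0 xy grow.
rewrite opprK => za; exists z; first by rewrite xz.
by rewrite rE clamp_id ?(le_trans x0 xz) ?(le_trans zy)// za.
Qed.

End reflected_path.

(** * The anticipating reflected equation *)

Section continuous_version.
Context {d : measure_display} {T : measurableType d} {R : realType}.
Variables (P : probability T R) (F : R -> set (set T)) (B : R -> {RV P >-> R}).
Hypothesis hB : brownian_motion F B.

(** On the null set where the path is discontinuous or does not start at [0] it is
  replaced by the zero path, so that all pathwise constructions hold for every
  point of the sample space. *)
Lemma brownian_continuous_version (sg : R) : exists beta : R -> T -> R,
  [/\ forall w, continuous (beta ^~ w), forall s, measurable_fun setT (beta s),
      forall w, beta 0 w = 0 &
      exists N : set T, [/\ measurable N, P N = 0 &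
        forall w, ~ N w -> forall s, 0 <= s <= 1 -> beta s w = sg * B s w]].
Proof.
have [N [mN N0 hN]] := filterI (brownian_start hB) (brownian_continuous hB).
have good w : ~ N w -> B 0 w = 0 /\ {within `[0, 1], continuous (fun t => B t w)}.
  by move=> Nw; apply: contrapT => bad; apply: Nw; exact: hN.
exists (fun s w => \1_(~` N) w * (sg * B (clamp s) w)); split.
- move=> w; have [Nw|Nw] := pselect (N w).
    have -> : (fun s => \1_(~` N) w * (sg * B (clamp s) w)) = fun=> 0 :> R.
      by apply/funext => s; rewrite indicE memNset ?mul0r//; exact.
    exact: continuous_const.
  apply: continuous_mul; first exact: continuous_const.
  apply: continuous_mul; first exact: continuous_const.
  exact: (clamp_extension_continuous (good w Nw).2).
- move=> s; apply: measurable_funM; last exact: measurable_funM.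
  by apply: measurable_indic; exact: measurableC.
- move=> w; have [Nw|Nw] := pselect (N w).
    by rewrite indicE memNset ?mul0r//; exact.
  by rewrite clamp_id ?lexx ?ler01// (good w Nw).1 !mulr0.
- exists N; split => // w Nw s s01.
  by rewrite indicE mem_set// mul1r clamp_id.
Qed.

End continuous_version.

Section reflected_equation.
Context {d : measure_display} {T : measurableType d} {R : realType}.
Variables (P : probability T R) (F : R -> set (set T)) (B : R -> {RV P >-> R}).
Hypotheses (hF : usual_filtration P F) (hB : brownian_motion F B).
Variables (sigma : R -> R) (Z : {RV P >-> R}).
Hypotheses (hsigma : twice_differentiable sigma) (hlip0 : lipschitz sigma)
  (hlip1 : lipschitz (derive1 sigma)) (hZ : forall w, 0 <= Z w).
Variables (sg : R).
Hypotheses (sg2 : sg ^+ 2 = 1) (sg_ge0 : 0 <= sg * sigma 0).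
Let s (x : R) := sg * sigma x.
Let s1 (x : R) := sg * derive1 sigma x.
Variables (k : R).
Hypotheses (k0 : 0 < k) (sk : forall x y, `|s x - s y| <= k * `|x - y|).
Variables (phi rho : R -> R -> R).
Hypotheses (phi0 : forall z, phi z 0 = z) (phis : forall z, solution s (phi z)).
Hypothesis rhoE : forall z, 0 <= z ->
  [/\ (exists2 a : R, 0 <= a & [/\ phi z (- a) = 0,
        (forall u : R, - a <= u -> 0 <= phi z u) &
        forall m, rho z m = Num.max 0 (m - a)]) \/
      ((forall u, 0 <= phi z u) /\ forall m, rho z m = 0) &
      forall m c : R, 0 <= c ->
        c < rho z m <-> [/\ 0 < s 0, c < m & z < phi 0 (m - c)]].
Variables (beta : R -> T -> R).
Hypotheses (cbeta : forall w, continuous (beta ^~ w))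
  (mbeta : forall s, measurable_fun setT (beta s)) (beta0 : forall w, beta 0 w = 0).
Variable N : set T.
Hypotheses (mN : measurable N) (N0 : P N = 0)
  (betaE : forall w, ~ N w -> forall s, 0 <= s <= 1 -> beta s w = sg * B s w).

(** The Skorokhod push, in the time scale of the flow. *)
Let push (t : R) (w : T) : R :=
  rho (Z w) (runmax (fun s => - beta s w) (clamp t)).
Let reflected (t : R) (w : T) : R := phi (Z w) (beta t w + push t w).
Let regulator (t : R) (w : T) : R := s 0 * push t w.

Let pushP w := (rhoE (hZ w)).1.

Let push_cont w : continuous (push ^~ w).
Proof. exact: (push_continuous (@cbeta w) (pushP w)). Qed.

Let push0 w : push 0 w = 0.
Proof. exact: (push_start (@cbeta w) (beta0 w) (pushP w)). Qed.

Let push_mono w x y : x <= y -> push x w <= push y w.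
Proof. exact: (push_homo (@cbeta w) (pushP w)). Qed.

Let push_growth w x y : 0 <= x -> x <= y -> y <= 1 -> push x w < push y w ->
  exists2 z, x <= z <= y & reflected z w = 0.
Proof. exact: (push_only_at_boundary (@cbeta w) (pushP w)). Qed.

(** The superlevel sets of [push] are expressed by the running maximum and the
  flow through [0] alone, with no reference to the hitting time [a]. *)
Let push_meas t : measurable_fun setT (push t).
Proof.
pose m w := runmax (fun s => - beta s w) (clamp t).
have mm : measurable_fun setT m.
  apply: (@measurable_runmax _ _ _ (fun s w => - beta s w)).
  - move=> w x; apply: continuousN; exact: cbeta.
  - by move=> x; exact: measurableT_comp.
  - by case/andP: (clamp_itv t).
apply: measurable_of_superlevel => c.
have [c0|c0] := ltP c 0.
  have -> : [set w | c < push t w] = setT; last exact: measurableT.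
  apply/seteqP; split => // w _ /=; apply: (lt_le_trans c0).
  rewrite /push; case: (rhoE (hZ w)).1 => [[a _ [_ _ ->]]|[_ ->]//].
  by rewrite le_max lexx.
have -> : [set w | c < push t w] =
    [set w | 0 < s 0] `&` ((m @^-1` `]c, +oo[%classic) `&`
    ((fun w => phi 0 (m w - c) - Z w) @^-1` `]0, +oo[%classic)).
  apply/seteqP; split => w /=; rewrite !in_itv/= !andbT.
    by move/((rhoE (hZ w)).2 _ _ c0) => [? ? ?]; rewrite subr_gt0.
  by rewrite subr_gt0 => -[? [? ?]]; apply/((rhoE (hZ w)).2 _ _ c0).
apply: measurableI.
  case: (0 < s 0).
    by have -> : [set _ | true] = setT :> set T by exact/seteqP.
  by have -> : [set _ | false] = set0 :> set T by apply/seteqP; split.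
apply: measurableI.
  by rewrite -[X in measurable X]setTI; exact: mm.
rewrite -[X in measurable X]setTI.
have mphi : measurable_fun setT (fun w => phi 0 (m w - c) - Z w).
  apply: measurable_funB => //.
  apply: (@measurable_flow _ _ _ s k phi (cst 0) (fun w => m w - c)) => //.
  exact: measurable_funB.
exact: mphi.
Qed.

Let arg_cont w : continuous (fun t => beta t w + push t w).
Proof. by apply: continuous_add; [exact: cbeta|exact: push_cont]. Qed.

Let arg_meas t : measurable_fun setT (fun w => beta t w + push t w).
Proof. exact: measurable_funD. Qed.

Let reflected_cont w : continuous (reflected ^~ w).
Proof.
exact: (continuous_compose (is_derive_continuous (phis (Z w))) (@arg_cont w)).
Qed.

Let reflected_meas t : measurable_fun setT (reflected t).
Proof.
exact: (measurable_flow k0 sk phi0 phis (measurable_funPT Z) (arg_meas t)).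
Qed.

Let regulator_cont w : continuous (regulator ^~ w).
Proof. by apply: continuous_mul; [exact: continuous_const|exact: push_cont]. Qed.

Let regulator_meas t : measurable_fun setT (regulator t).
Proof. exact: measurable_funM. Qed.

Let sigma_cont : continuous sigma.
Proof. by have [k' _ /lipschitz_continuous] := lipschitz_bound hlip0. Qed.

Let s_cont : continuous s.
Proof. by apply: continuous_mul; [exact: continuous_const|exact: sigma_cont]. Qed.

Let s1_cont : continuous s1.
Proof.
apply: continuous_mul; first exact: continuous_const.
by have [k' _ /lipschitz_continuous] := lipschitz_bound hlip1.
Qed.

Let s_derive (x : R) : is_derive x 1 s (s1 x).
Proof.
apply: is_derive1Zl; rewrite derive1E; apply: DeriveDef => //.
exact: (hsigma x).1.
Qed.

Let sX_cont w : continuous (fun t => sigma (reflected t w)).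
Proof. exact: (continuous_compose sigma_cont (@reflected_cont w)). Qed.

Let sX_meas t : measurable_fun setT (fun w => sigma (reflected t w)).
Proof. exact: (measurableT_comp (continuous_measurable_fun sigma_cont)). Qed.

Let L_mono w x y : 0 <= x -> x <= y -> y <= 1 -> regulator x w <= regulator y w.
Proof. by move=> _ xy _; rewrite /regulator ler_wpM2l//; exact: push_mono. Qed.

Let L_growth w x y : 0 <= x -> x <= y -> y <= 1 -> regulator x w < regulator y w ->
  exists2 z, x <= z <= y & reflected z w = 0.
Proof.
move=> x0 xy y1 lt_L; apply: push_growth => //.
rewrite lt_neqAle push_mono// andbT; apply/eqP => e.
by move: lt_L; rewrite /regulator e ltxx.
Qed.

Let stoch_part (t : R) (w : T) : R := reflected t w - Z w - regulator t w.

Let stoch_part_meas t : measurable_fun setT (stoch_part t).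
Proof. by apply: measurable_funB => //; exact: measurable_funB. Qed.

(** [likely_strat_sum] for the primitive [phi (Z w)]: along the path its derivative
  is [s] of the reflected process, and the two signs [sg] in [s] and [beta]
  cancel. *)
Let stratonovich_sum_close t e h : 0 <= t <= 1 -> 0 < e -> 0 < h ->
  exists2 delta : R, 0 < delta & forall p, itv_partition 0 t p -> mesh p < delta ->
    likely P h (fun w => ~ N w ->
      `|strat_sum (fun s => B s : T -> R) (fun u w => sigma (reflected u w)) p w - stoch_part t w| <= e).
Proof.
move=> t01 e0 h0.
have betaE' x : 0 <= x <= 1 -> {ae P, forall w, beta x w = sg * B x w}.
  move=> x01; exists N; split => // w; apply: contra_notP => Nw.
  exact: betaE.
have dG w (x : R) : is_derive x 1 (phi (Z w)) (s (phi (Z w) x)) := phis (Z w) x.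
have dg w (x : R) : is_derive x 1 (fun x => s (phi (Z w) x))
    (s1 (phi (Z w) x) * s (phi (Z w) x)).
  have ds := s_derive (phi (Z w) x).
  have := is_derive1_comp ds (dG w x).
  by rewrite mulrC.
have cphi w : continuous (fun x => phi (Z w) x) := is_derive_continuous (phis (Z w)).
have cg1 w : continuous (fun x => s1 (phi (Z w) x) * s (phi (Z w) x)).
  by apply: continuous_mul; apply: continuous_compose.
have ms x : measurable_fun setT (fun w => s (reflected x w)).
  exact: (measurableT_comp (continuous_measurable_fun s_cont)).
have ms1 x : measurable_fun setT (fun w => s1 (reflected x w) * s (reflected x w)).
  apply: measurable_funM => //.
  exact: (measurableT_comp (continuous_measurable_fun s1_cont)).
have grow w x y : 0 <= x -> x <= y -> y <= 1 -> push x w < push y w ->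
    exists2 z, x <= z <= y & s (phi (Z w) (beta z w + push z w)) = s 0.
  move=> x0 xy y1 /(push_growth x0 xy y1)[z xzy Xz]; exists z => //.
  by move: Xz; rewrite /reflected => ->.
have [delta delta0 H] := likely_strat_sum hF hB sg2 cbeta mbeta betaE'
  dG dg cg1 push_cont push_meas ms ms1 (fun w x y _ xy _ => push_mono w xy) grow t01 e0 h0.
exists delta => // p pp mp.
apply: (likely_weaken (lexx h) _ (H p pp mp)) => w Hw Nw.
suff -> : strat_sum (fun s => B s : T -> R) (fun u w => sigma (reflected u w)) p w - stoch_part t w =
  \sum_(k < size p) avg (fun u => s (phi (Z w) (beta u w + push u w))) (pt p k) (pt p k.+1)
    * (beta (pt p k.+1) w - beta (pt p k) w)
  - (phi (Z w) (beta t w + push t w) - phi (Z w) (beta 0 w + push 0 w)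
     - s 0 * (push t w - push 0 w)) by [].
congr (_ - _); last by rewrite push0 beta0 addr0 subr0 phi0.
apply: eq_bigr => i _.
have lt_pt := pt_lt pp (ltn_ord i).
have /andP[pi0 pit] := pt_itv pp (ltnW (ltn_ord i)).
have /andP[pi0' pit'] := pt_itv pp (ltn_ord i).
have /andP[t0 t1] := t01.
rewrite !betaE ?pi0 ?pi0' ?(le_trans pit) ?(le_trans pit')//.
rewrite -avgE//; last first.
  exact: (continuous_compose s_cont (@reflected_cont w)).
have -> : (\int[lebesgue_measure]_(u in `[pt p i, pt p i.+1]) s (phi (Z w) (beta u w + push u w)))%R
    = sg * (\int[lebesgue_measure]_(u in `[pt p i, pt p i.+1]) sigma (reflected u w))%R.
  rewrite /s RintegralZl//.
  exact: (@continuous_integrable_segment R (fun u => sigma (reflected u w))).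
move: (\int[lebesgue_measure]_(_ in _) _)%R (_^-1) (B _ w) (B _ w) => J a y x.
have -> : a * (sg * J) * (sg * x - sg * y) = sg ^+ 2 * (a * J * (x - y)) by ring.
by rewrite sg2 mul1r.
Qed.

Let stratonovich_integral t (I : {RV P >-> R}) : 0 <= t <= 1 -> (forall w, I w = stoch_part t w) ->
  is_strat_integral B (fun u w => sigma (reflected u w)) t I.
Proof.
move=> t01 IE; split.
- apply: (measurable_funS measurableT (@subsetT _ _)).
  exact: (measurable_continuous_process (V := fun u w => sigma (reflected u w)) sX_cont sX_meas).
- apply: aeW => w.
  have /integrableP[_] := @continuous_integrable_segment R (fun u => sigma (reflected u w)) 0 t
    (@sX_cont w).
  by [].
- move=> e h e0 h0; have [delta delta0 H] := stratonovich_sum_close t01 e0 h0.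
  exists delta => // p pp mp.
  have [A [mA PA HA]] := H p pp mp.
  have mS : measurable_fun setT (strat_sum (fun s => B s : T -> R) (fun u w => sigma (reflected u w)) p).
    exact: measurable_strat_sum.
  apply: (@le_trans _ _ (P (A `|` N))); last first.
    apply: (le_trans (measureU2 _ _ _)) => //.
    by rewrite [X in (_ + X)%E]N0 adde0.
  apply: le_measure; rewrite ?inE.
  + have mD : measurable_fun setT (fun w => `|strat_sum (fun s => B s : T -> R)
      (fun u w => sigma (reflected u w)) p w - I w|).
      by apply: measurableT_comp => //; exact: measurable_funB.
    rewrite -[X in measurable X]setTI.
    have -> : [set w | e < `|strat_sum (fun s => B s : T -> R) (fun u w => sigma (reflected u w)) p w
      - I w|] = (fun w => `|strat_sum (fun s => B s : T -> R)
      (fun u w => sigma (reflected u w)) p w - I w|) @^-1` `]e, +oo[%classic.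
      by apply/seteqP; split => w /=; rewrite in_itv/= andbT.
    exact: mD.
  + exact: measurableU.
  + move=> w /= lt_e; have [Nw|Nw] := pselect (N w); [by right|left].
    apply: contrapT => Aw; have := HA w Aw Nw.
    by rewrite -IE leNgt lt_e.
Qed.

Lemma ex_reflected_solution : exists X L : R -> {RV P >-> R},
    [/\ solves_reflected_sde B sigma Z X L,
        forall w, X 0 w = Z w /\ (forall t : R, 0 <= t <= 1 -> 0 <= X t w),
        forall w, {within `[0, 1], continuous (fun t => X t w)} /\
                  {within `[0, 1], continuous (fun t => L t w)} &
        forall w,
          [/\ {in `[0, 1] &, {homo (fun t => L t w) : s t / s <= t}},
              L 0 w = 0 &
              forall t : R, 0 <= t <= 1 ->
                is_stieltjes_integral (\1_[set s | X s w = 0])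
                  (fun s => L s w) t (L t w)]].
Proof.
pose X t : {RV P >-> R} := HB.pack (reflected t) (isMeasurableFun.Build _ _ _ _ _ (reflected_meas t)).
pose L t : {RV P >-> R} := HB.pack (regulator t) (isMeasurableFun.Build _ _ _ _ _ (regulator_meas t)).
exists X, L; split.
- move=> t t01.
  pose I : {RV P >-> R} := HB.pack (stoch_part t) (isMeasurableFun.Build _ _ _ _ _ (stoch_part_meas t)).
  exists I; first exact: (stratonovich_integral t01).
  by apply: aeW => w; rewrite /= /stoch_part; ring.
- move=> w; split; first by rewrite /= /reflected push0 beta0 addr0 phi0.
  by move=> t; exact: (pushed_path_ge0 (@cbeta w) (pushP w)).
- move=> w; split; apply: continuous_subspaceT; [exact: reflected_cont|exact: regulator_cont].
- move=> w; have L0 : regulator 0 w = 0 by rewrite /regulator push0 mulr0.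
  split => //.
  + move=> x y; rewrite !in_itv/= => /andP[x0 _] /andP[_ y1] xy.
    exact: L_mono.
  + move=> t t01.
    exact: (stieltjes_supported_on_zeros (@reflected_cont w) (@regulator_cont w) L0 (@L_mono w) (@L_growth w)).
Qed.

End reflected_equation.

Theorem theorem1p1 (R : realType) (d : measure_display) (T : measurableType d)
    (P : probability T R) (F : R -> set (set T)) (B : R -> {RV P >-> R})
    (sigma : R -> R) (Z : {RV P >-> R})
    (hF : usual_filtration P F)
    (hB : brownian_motion F B)
    (hsigma : twice_differentiable sigma)
    (hlip0 : lipschitz sigma)
    (hlip1 : lipschitz (derive1 sigma))
    (hlip2 : lipschitz (derive1n 2 sigma))
    (hZ : forall w, 0 <= Z w) :
  exists X L : R -> {RV P >-> R},
    [/\ solves_reflected_sde B sigma Z X L,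
        forall w, X 0 w = Z w /\ (forall t : R, 0 <= t <= 1 -> 0 <= X t w),
        forall w, {within `[0, 1], continuous (fun t => X t w)} /\
                  {within `[0, 1], continuous (fun t => L t w)} &
        forall w,
          [/\ {in `[0, 1] &, {homo (fun t => L t w) : s t / s <= t}},
              L 0 w = 0 &
              forall t : R, 0 <= t <= 1 ->
                is_stieltjes_integral (\1_[set s | X s w = 0])
                  (fun s => L s w) t (L t w)]].
Proof.
(* this sign makes the flow through [0] enter the half line when time grows *)
have [sg sg2 sg_ge0] : exists2 sg : R, sg ^+ 2 = 1 & 0 <= sg * sigma 0.
  have [h|h] := leP 0 (sigma 0); first by exists 1; rewrite ?expr1n// mul1r.
  by exists (- 1); rewrite ?sqrrN ?expr1n// mulN1r oppr_ge0 ltW.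
have [k k0 sk] := lipschitz_bound hlip0.
pose s x := sg * sigma x.
have {}sk x y : `|s x - s y| <= k * `|x - y|.
  rewrite /s -mulrBr normrM; have -> : `|sg| = 1; last by rewrite mul1r.
  by apply/eqP; rewrite -(@eqrXn2 _ 2)// expr1n real_normK ?num_real// sg2.
have [phi phiP] := choice (fun z => let: ex_intro2 f f0 fs := ex_solution k0 sk z in
  ex_intro (fun f => f 0 = z /\ solution s f) f (conj f0 fs)).
have phi0 z := (phiP z).1; have phis z := (phiP z).2.
have [rho rhoE] := ex_reflection_time k0 sk phi0 phis sg_ge0.
have [beta [cbeta mbeta beta0 [N [mN N0 betaE]]]] := brownian_continuous_version hB sg.
exact: (ex_reflected_solution hF hB hsigma hlip0 hlip1 hZ sg2 sg_ge0 k0 sk phi0 phis rhoE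
  cbeta mbeta beta0 mN N0 betaE).
Qed.
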